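(* Let $\mathcal G$ be a finite nonempty collection of allowed words of $\Sigma_A$, all of length $2$, and let $\phi_P:\Sigma_A\to\mathbb R$ be $\phi_P(x)=\ln P_{x_1x_2}$. Then $$\rho(H_{\mathcal G})=\mathcal P_A(\phi_P)-\mathcal P_{B_{\mathcal G}}(\phi_P),$$ where $\mathcal P_A(\phi_P)$ is the topological pressure of $\phi_P$ on $(\Sigma_A,\sigma)$ and $\mathcal P_{B_{\mathcal G}}(\phi_P)$ is the topological pressure of the restriction of $\phi_P$ to $(\Sigma_{B_{\mathcal G}},\sigma)$ (with the convention that the pressure is $-\infty$ if $\Sigma_{B_{\mathcal G}}=\emptyset$, and $-\ln 0=+\infty$).
   Context: Let $\Sigma=\{1,\dots,N\}$, $A$ an irreducible $N\times N$ $0$–$1$ matrix, $\Sigma_A=\{x\in\Sigma^{\mathbb N}:A_{x_nx_{n+1}}=1\ \forall n\}$ with left shift $\sigma$; $\mathcal L_2$ is the set of allowed words of length $2$ (occurring in some element of $\Sigma_A$); $C_w$ is the set of $x\in\Sigma_A$ beginning with $w$. $P$ is a row-stochastic matrix with $P_{ij}>0$ iff $A_{ij}=1$, $\mathbf p$ its stationary vector, $\mu=\mu_P$ the Markov measure $\mu(C_w)=p_{w_1}P_{w_1w_2}\cdots P_{w_{n-1}w_n}$. $H_{\mathcal G}=\bigcup_{w\in\mathcal G}C_w$; $\mathcal W_m=\{x:\sigma^ix\notin H_{\mathcal G},0\le i\le m\}$, $\rho(H_{\mathcal G})=-\lim_m\frac1m\ln\mu(\mathcal W_m)$. Since all words in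 $\mathcal G$ have length 2, $B_{\mathcal G}$ is the $0$–$1$ matrix indexed by $\Sigma$ with $(B_{\mathcal G})_{ij}=1$ iff $ij\in\mathcal L_2$ and $ij\notin\mathcal G$; $\Sigma_{B_{\mathcal G}}=\{x\in\Sigma^{\mathbb N}:(B_{\mathcal G})_{x_nx_{n+1}}=1\ \forall n\}\subseteq\Sigma_A$. For a compact shift-invariant $Y\subseteq\Sigma_A$ and continuous $\phi$, the pressure is $\sup\{h_\nu(\sigma)+\int_Y\phi\,d\nu\}$ over $\sigma$-invariant Borel probability measures $\nu$ on $Y$, $h_\nu$ being measure-theoretic entropy. *)

(* Defs.v *)
From HB Require Import structures.
From mathcomp Require Import all_boot all_order all_algebra.
From mathcomp Require Import all_classical all_reals all_analysis.

Set Implicit Arguments.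
Unset Strict Implicit.
Unset Printing Implicit Defensive.

Import Order.TTheory GRing.Theory Num.Theory.
Import numFieldNormedType.Exports.
Local Open Scope classical_set_scope.
Local Open Scope ring_scope.

(* Alphabet Sigma = 'I_n.+1  (N = n.+1 symbols, relabelled 0..n).
   Sequence space Sigma^N = nat -> 'I_n.+1 (x_1 x_2 ... is x 0, x 1, ...). *)
Definition seqsp (n : nat) := nat -> 'I_n.+1.
HB.instance Definition _ n := gen_eqMixin (seqsp n).
HB.instance Definition _ n := gen_choiceMixin (seqsp n).
HB.instance Definition _ n := isPointed.Build (seqsp n) (fun _ => ord0).

Section Defs.
Variable n : nat.

Definition shift (x : seqsp n) : seqsp n := fun k => x k.+1.

Definition cyl (w : seq 'I_n.+1) : set (seqsp n) :=
  [set x | forall i, (i < size w)%N -> x i = nth ord0 w i].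

Definition cylinders : set (set (seqsp n)) := [set C | exists w, C = cyl w].

(* Sigma^N with the sigma-algebra generated by cylinders
   (= Borel sigma-algebra of the product topology). *)
Definition SpaceT := g_sigma_algebraType cylinders.

Variable R : realType.

Definition zero_one (A : 'M[R]_n.+1) := forall i j, A i j = 0 \/ A i j = 1.
Definition irreducible_mx (A : 'M[R]_n.+1) :=
  forall i j, exists m : nat, 0 < (A ^+ m.+1) i j.

Definition sft (A : 'M[R]_n.+1) : set SpaceT :=
  [set x | forall k, A (x k) (x k.+1) = 1].

Definition allowed2 (A : 'M[R]_n.+1) (i j : 'I_n.+1) : Prop :=
  exists x, sft A x /\ x 0%N = i /\ x 1%N = j.

Definition B_mx (A : 'M[R]_n.+1) (G : {set 'I_n.+1 * 'I_n.+1}) : 'M[R]_n.+1 :=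
  \matrix_(i, j) (if `[< allowed2 A i j >] && ((i, j) \notin G) then 1 else 0).

Definition compatible_stochastic (A P : 'M[R]_n.+1) :=
  (forall i j, 0 <= P i j) /\ (forall i, \sum_j P i j = 1) /\
  (forall i j, 0 < P i j <-> A i j = 1).
Definition stationary (P : 'M[R]_n.+1) (p : 'rV[R]_n.+1) :=
  (forall i, 0 <= p 0 i) /\ \sum_i p 0 i = 1 /\ p *m P = p.

Fixpoint chainprod (P : 'M[R]_n.+1) (a : 'I_n.+1) (ws : seq 'I_n.+1) : R :=
  if ws is b :: ws' then P a b * chainprod P b ws' else 1.

Definition is_markov_measure (P : 'M[R]_n.+1) (p : 'rV[R]_n.+1)
  (mu : probability SpaceT R) :=
  forall a ws, mu (cyl (a :: ws)) = (p 0 a * chainprod P a ws)%:E.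

Definition hole (G : {set 'I_n.+1 * 'I_n.+1}) : set SpaceT :=
  \bigcup_(w in [set w | w \in G]) cyl [:: w.1; w.2].
Definition survivors (A : 'M[R]_n.+1) (G : {set 'I_n.+1 * 'I_n.+1}) (m : nat)
  : set SpaceT :=
  [set x | sft A x /\ forall i, (i <= m)%N -> ~ hole G (iter i shift x)].

Definition eln (e : \bar R) : \bar R :=
  if e == 0%E then -oo%E else (ln (fine e))%:E.

(* the sequence -(1/m) ln mu(W_m), whose limit is rho(H_G) *)
Definition escape_seq (A : 'M[R]_n.+1) (G : {set 'I_n.+1 * 'I_n.+1})
  (mu : probability SpaceT R) (m : nat) : \bar R :=
  (- ((m%:R)^-1)%:E * eln (mu (survivors A G m)))%E.

Definition phiP (P : 'M[R]_n.+1) (x : SpaceT) : R := ln (P (x 0%N) (x 1%N)).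

Definition is_partition k (al : 'I_k -> set SpaceT) :=
  (forall i, measurable (al i)) /\
  (forall i j, i != j -> al i `&` al j = set0) /\
  (forall x, exists i, al i x).

Definition joincell k (al : 'I_k -> set SpaceT) m (s : {ffun 'I_m -> 'I_k})
  : set SpaceT := [set x | forall j : 'I_m, al (s j) (iter j shift x)].

Definition eta (t : R) : R := - (t * ln t).

Definition part_entropy (nu : probability SpaceT R) k (al : 'I_k -> set SpaceT)
  m : R := \sum_(s : {ffun 'I_m -> 'I_k}) eta (fine (nu (joincell al s))).

Definition entropy_wrt (nu : probability SpaceT R) k (al : 'I_k -> set SpaceT)
  : R := limn (fun m => part_entropy nu al m / m%:R).

Definition ks_entropy (nu : probability SpaceT R) : \bar R :=
  ereal_sup [set e | exists k (al : 'I_k -> set SpaceT),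
                     is_partition al /\ e = (entropy_wrt nu al)%:E].

Definition shift_invariant (nu : probability SpaceT R) :=
  forall E : set SpaceT, measurable E -> nu (shift @^-1` E) = nu E.

(* pressure via the variational formula, over invariant Borel probability
   measures on Y (= probability measures on Sigma^N giving Y full mass);
   sup of the empty set is -oo *)
Definition pressure (Y : set SpaceT) (phi : SpaceT -> R) : \bar R :=
  ereal_sup [set (ks_entropy nu + \int[nu]_(x in Y) (phi x)%:E)%E
            | nu in [set nu : probability SpaceT R |
                      nu Y = 1%E /\ shift_invariant nu]].

End Defs.

(* Main.v *)
(** Let M be P restricted to the edges of a 0-1 matrix C and let Z_m be the sum,
    over all words with m edges, of the products of the entries of M. Everything
    reduces to (1/m) ln Z_m -> pressure (sft C). Indeed Z_m is constant for C = A,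
    so that the pressure on sft A is 0, and since the stationary vector is positive,
    mu(W_m) is comparable to Z_(m+1) for C = B_G.

    Both inequalities come from Gibbs' inequality. For an invariant measure on
    sft C and a finite partition, approximate the partition by cylinder sets and
    compare the joint law of words and itineraries with the Gibbs weights
    prod M / Z_m times a channel with small error; this bounds entropy plus
    integral by liminf (1/m) ln Z_m. Conversely, let q_m be the average edge
    frequency of a word drawn with the Gibbs weights. Comparing with the Markov
    chain of q_m bounds (1/m) ln Z_m by the free energy of q_m up to O(1/m).
    A limit q of the q_m along an ultrafilter is stationary, and its free energy is
    entropy plus integral for the Markov measure of q, which is built as the image
    of Lebesgue measure under interval coding. *)

Require Import Defs.
From HB Require Import structures.
From mathcomp Require Import all_boot all_order all_algebra.
From mathcomp Require Import all_classical all_reals all_analysis.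
From mathcomp Require Import lra ring.
(* Again, because MathComp-Analysis shadows [eta] and [shift]. *)
Import Defs.
Import Order.TTheory GRing.Theory Num.Theory.
Import numFieldNormedType.Exports.
Local Open Scope classical_set_scope.
Local Open Scope ring_scope.

Set Implicit Arguments.
Unset Strict Implicit.
Unset Printing Implicit Defensive.

(** * Gibbs' inequality and weights of words *)

Section Finite.
Variable R : realType.
Implicit Types (T U : finType).

Lemma ln_le_sub1 (x : R) : 0 < x -> ln x <= x - 1.
Proof.
by move=> x0; have := @le_ln1Dx R (x - 1); rewrite addrCA subrr addr0; apply; lra.
Qed.

Lemma ln_prod T (f : T -> R) :
  (forall i, 0 < f i) -> ln (\prod_i f i) = \sum_i ln (f i).
Proof.
move=> f0.
suff [] : 0 < \prod_i f i /\ ln (\prod_i f i) = \sum_i ln (f i) by [].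
elim/big_rec2: _ => [|i y1 y2 _ [y20 <-]]; first by rewrite ln1.
by split; [exact: mulr_gt0 | rewrite lnM ?posrE].
Qed.

(* Gibbs' inequality for [d] bounds the entropy of [d], hence that of its image
   under [g], since passing to an image lowers entropy. *)
Lemma gibbs_marginal T U (g : T -> U) (d tau : T -> R) :
  (forall t, 0 <= d t) -> \sum_t d t = 1 ->
  (forall t, 0 <= tau t) -> \sum_t tau t <= 1 ->
  (forall t, 0 < d t -> 0 < tau t) ->
  \sum_u eta (\sum_(t | g t == u) d t) <= - \sum_t d t * ln (tau t).
Proof.
move=> d0 d1 tau0 tau1 dtau; pose e u := \sum_(t | g t == u) d t.
have de t : d t <= e (g t).
  by rewrite /e (bigD1 t) //= lerDl sumr_ge0.
have -> : \sum_u eta (e u) = - \sum_t d t * ln (e (g t)).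
  rewrite [in RHS](partition_big g predT) //= -sumrN; apply: eq_bigr => u _.
  rewrite /eta (_ : e u * _ = (\sum_(t | g t == u) d t) * ln (e u)) // mulr_suml.
  by congr (- _); apply: eq_bigr => t /eqP <-.
rewrite lerN2 -subr_ge0 -sumrB.
(* This sum is nonnegative since [tau] has mass at most 1. Termwise, [ln x <= x - 1] is used at
   [x = tau t / e (g t)], then weakened by [d t <= e (g t)]. *)
apply: (@le_trans _ _ (\sum_t (d t - tau t))).
  by rewrite sumrB d1 subr_ge0.
apply: ler_sum => t _; rewrite -mulrBr.
have [->|dn0] := eqVneq (d t) 0; first by rewrite mul0r sub0r oppr_le0.
have dt : 0 < d t by rewrite lt_neqAle eq_sym dn0 d0.
have et : 0 < e (g t) by exact: lt_le_trans (de t).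
have taut := dtau _ dt.
have : ln (tau t / e (g t)) <= tau t / e (g t) - 1.
  by apply: ln_le_sub1; rewrite divr_gt0.
rewrite ln_div ?posrE// => h.
have : tau t / e (g t) <= tau t / d t.
  by rewrite ler_pM2l// lef_pV2 ?posrE.
move=> h2; have h3 : 1 - tau t / d t <= ln (e (g t)) - ln (tau t) by lra.
have -> : d t - tau t = d t * (1 - tau t / d t).
  by rewrite mulrBr mulr1 mulrCA divff ?mulr1// gt_eqF.
by rewrite ler_pM2l.
Qed.

Lemma gibbs T (d tau : T -> R) :
  (forall t, 0 <= d t) -> \sum_t d t = 1 ->
  (forall t, 0 <= tau t) -> \sum_t tau t <= 1 ->
  (forall t, 0 < d t -> 0 < tau t) ->
  \sum_t eta (d t) <= - \sum_t d t * ln (tau t).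
Proof.
move=> d0 d1 tau0 tau1 dtau; have := @gibbs_marginal T T id d tau d0 d1 tau0 tau1 dtau.
by under eq_bigr do rewrite (big_pred1 _ (fun t => erefl)).
Qed.

End Finite.

Section Words.
Variables (R : realType) (n : nat).
Implicit Types (M : 'M[R]_n.+1) (a b : 'I_n.+1).

Lemma big_tuple_cons (m : nat) (F : m.+1.-tuple 'I_n.+1 -> R) :
  \sum_(w : m.+1.-tuple 'I_n.+1) F w =
  \sum_a \sum_(t : m.-tuple 'I_n.+1) F [tuple of a :: t].
Proof.
rewrite pair_big /=.
rewrite (reindex (fun at_ : 'I_n.+1 * m.-tuple 'I_n.+1 => [tuple of at_.1 :: at_.2])) //=.
exists (fun w : m.+1.-tuple _ => (thead w, [tuple of behead w])) => [[a t] _|w _] /=.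
  by rewrite theadE; congr pair; apply: val_inj.
by rewrite [w in RHS]tuple_eta; apply: val_inj.
Qed.

Definition wt M (w : seq 'I_n.+1) : R :=
  if w is a :: ws then chainprod M a ws else 1.

Lemma wtE M m (w : m.+1.-tuple 'I_n.+1) :
  wt M w = \prod_(j < m) M (nth ord0 w j) (nth ord0 w j.+1).
Proof.
case: w => -[//|a ws] /= /eqP[] <- {m}.
elim: ws a => [|b ws IH] a /=; first by rewrite big_ord0.
by rewrite big_ord_recl /= IH.
Qed.

(** The entry at [a] of the [m]-th power of [M] applied to the all-ones vector. *)
Fixpoint Zfrom M m a : R :=
  if m is m'.+1 then \sum_b M a b * Zfrom M m' b else 1.

Definition Z M m : R := \sum_a Zfrom M m a.

Lemma sum_chainprod M m a :
  \sum_(t : m.-tuple 'I_n.+1) chainprod M a t = Zfrom M m a.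
Proof.
elim: m a => [|m IH] a /=.
  by rewrite (big_pred1 [tuple]) // => t; exact/esym/eqP/tuple0.
rewrite big_tuple_cons /=; apply: eq_bigr => b _.
by rewrite -IH mulr_sumr.
Qed.

Lemma sum_init_chainprod (f : 'I_n.+1 -> R) M m :
  \sum_(w : m.+1.-tuple 'I_n.+1) f (thead w) * wt M w = \sum_a f a * Zfrom M m a.
Proof.
rewrite big_tuple_cons; apply: eq_bigr => a _.
by rewrite -sum_chainprod mulr_sumr; apply: eq_bigr => t _; rewrite theadE.
Qed.

Lemma sum_wt M m : \sum_(w : m.+1.-tuple 'I_n.+1) wt M w = Z M m.
Proof.
have := sum_init_chainprod (fun=> 1) M m.
by under eq_bigr do rewrite mul1r; move=> ->; apply: eq_bigr => a _; rewrite mul1r.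
Qed.

Section Substochastic.
Variable M : 'M[R]_n.+1.
Hypothesis M0 : forall i j, 0 <= M i j.

Lemma wt_ge0 w : 0 <= wt M w.
Proof.
by case: w => // a w /=; elim: w a => //= b w IH a; rewrite mulr_ge0.
Qed.

Lemma Zfrom_ge0 m a : 0 <= Zfrom M m a.
Proof. by elim: m a => //= m IH a; apply: sumr_ge0 => b _; rewrite mulr_ge0. Qed.

Hypothesis M1 : forall i, \sum_j M i j <= 1.

Lemma Zfrom_decr m a : Zfrom M m.+1 a <= Zfrom M m a.
Proof.
elim: m a => [|m IH] a /=; first by under eq_bigr do rewrite mulr1.
by apply: ler_sum => b _; exact: (ler_wpM2l (M0 a b) (IH b)).
Qed.

Lemma Zfrom_le1 m a : Zfrom M m a <= 1.
Proof. by elim: m => // m IH; exact: le_trans (Zfrom_decr _ _) IH. Qed.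

(** With row sums at most 1, an added edge never increases the total weight. This trades [m + L]
    edges for [m] in the entropy bound and makes a zero of [Z] persist. *)
Lemma Z_nonincr m k : (m <= k)%N -> Z M k <= Z M m.
Proof.
move/subnK <-; elim: (k - m)%N => // l IH.
by rewrite addSn; apply: le_trans IH; apply: ler_sum => a _; exact: Zfrom_decr.
Qed.

Lemma Z_le m : Z M m <= n.+1%:R.
Proof.
rewrite -[n.+1 in leRHS]card_ord -sumr_const.
by apply: ler_sum => a _; exact: Zfrom_le1.
Qed.

Lemma Z_ge0 m : 0 <= Z M m.
Proof. by apply: sumr_ge0 => a _; exact: Zfrom_ge0. Qed.

End Substochastic.

Lemma Zfrom_stochastic M m a : (forall i, \sum_j M i j = 1) -> Zfrom M m a = 1.
Proof.
move=> M1; elim: m a => //= m IH a.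
by under eq_bigr do rewrite IH mulr1.
Qed.

Lemma Z_stochastic M m : (forall i, \sum_j M i j = 1) -> Z M m = n.+1%:R.
Proof.
move=> M1; rewrite /Z; under eq_bigr do rewrite Zfrom_stochastic//.
by rewrite sumr_const card_ord.
Qed.

End Words.

(** * Laws of finite-valued maps *)

Section MeasurableFibers.
Variables (d : measure_display) (X : measurableType d).
Implicit Types (T U : finType).

(** Measurability into a finite type, stated by fibers so that no sigma-algebra has to be put on
    [T]. *)
Definition measurable_fibers T (f : X -> T) :=
  forall t, measurable (f @^-1` [set t]).

Lemma measurable_forall T (E : T -> set X) :
  (forall i, measurable (E i)) -> measurable [set x | forall i, E i x].
Proof.
move=> mE; rewrite (_ : [set _ | _] = \bigcap_(i in [set: T]) E i).
  by apply: fin_bigcap_measurable => //; exact: finite_finset.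
by apply/seteqP; split=> [x h i _|x h i]; [exact: h|exact: (h i)].
Qed.

Lemma measurable_fibers_pred T (f : X -> T) (Q : pred T) :
  measurable_fibers f -> measurable [set x | Q (f x)].
Proof.
move=> mf; rewrite (_ : [set _ | _] = \bigcup_(t in [set t | Q t]) f @^-1` [set t]).
  by apply: fin_bigcup_measurable => //; exact: finite_finset.
by apply/seteqP; split=> [x Qx|x [t Qt /= ->]] //; exists (f x).
Qed.

Lemma measurable_fibers_comp T U (f : X -> T) (h : T -> U) :
  measurable_fibers f -> measurable_fibers (h \o f).
Proof.
move=> mf u; rewrite (_ : _ @^-1` _ = [set x | h (f x) == u]).
  exact: (measurable_fibers_pred (fun t => h t == u)).
by apply/seteqP; split=> x /= /eqP.
Qed.

Lemma measurable_fibers_pair T U (f : X -> T) (g : X -> U) :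
  measurable_fibers f -> measurable_fibers g ->
  measurable_fibers (fun x => (f x, g x)).
Proof.
move=> mf mg [t u].
rewrite (_ : _ @^-1` _ = f @^-1` [set t] `&` g @^-1` [set u]).
  exact: measurableI.
by apply/seteqP; split=> x /= [-> ->].
Qed.

Lemma measurable_fibers_ffun T U (f : T -> X -> U) :
  (forall i, measurable_fibers (f i)) ->
  measurable_fibers (fun x => [ffun i => f i x]).
Proof.
move=> mf g; rewrite (_ : _ @^-1` _ = [set x | forall i, (f i @^-1` [set g i]) x]).
  by apply: measurable_forall => i; exact: mf.
apply/seteqP; split=> x /=; first by move=> <- i; rewrite ffunE.
by move=> h; apply/ffunP => i; rewrite ffunE.
Qed.

End MeasurableFibers.

Section Law.
Variables (d : measure_display) (X : measurableType d) (R : realType).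
Variable nu : probability X R.
Implicit Types (T U : finType) (E F Y : set X).

Definition pr E : R := fine (nu E).

Lemma prE E : measurable E -> nu E = (pr E)%:E.
Proof. by move=> mE; rewrite fineK // fin_num_measure. Qed.

Lemma pr_ge0 E : 0 <= pr E.
Proof. by rewrite fine_ge0 // measure_ge0. Qed.

Lemma pr_mono E F : measurable E -> measurable F -> E `<=` F -> pr E <= pr F.
Proof.
by move=> mE mF EF; rewrite -lee_fin -!prE //; apply: le_measure; rewrite ?inE.
Qed.

Lemma pr_le1 E : measurable E -> pr E <= 1.
Proof. by move=> mE; rewrite -lee_fin -prE // probability_le1. Qed.

Lemma pr_disjU E F : measurable E -> measurable F -> E `&` F = set0 ->
  pr (E `|` F) = pr E + pr F.
Proof.
move=> mE mF EF; apply: EFin_inj.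
by rewrite EFinD -!prE ?measureU //; exact: measurableU.
Qed.

Lemma prU E F : measurable E -> measurable F -> pr (E `|` F) <= pr E + pr F.
Proof.
move=> mE mF; rewrite -lee_fin EFinD -!prE ?measureU2 //; exact: measurableU.
Qed.

Lemma prT : pr setT = 1.
Proof. by rewrite /pr probability_setT. Qed.

Lemma pr_setI_full Y E : measurable Y -> nu Y = 1%E -> measurable E ->
  pr (E `&` Y) = pr E.
Proof.
move=> mY Y1 mE; apply/eqP; rewrite eq_le pr_mono //=; last exact: measurableI.
have mC : measurable (E `&` ~` Y) by apply: measurableI => //; exact: measurableC.
have -> : pr E = pr (E `&` Y) + pr (E `&` ~` Y).
  rewrite -pr_disjU //; last by rewrite setIACA setICr setI0.
    by rewrite -setIUr setUCr setIT.
  exact: measurableI.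
rewrite gerDl.
have -> : 0 = pr (~` Y) by rewrite /pr probability_setC // Y1 subee.
by apply: pr_mono => //; exact: measurableC.
Qed.

Definition law T (f : X -> T) (t : T) : R := pr (f @^-1` [set t]).

Lemma law_seq T (f : X -> T) (s : seq T) : measurable_fibers f -> uniq s ->
  pr [set x | f x \in s] = \sum_(t <- s) law f t.
Proof.
move=> mf; elim: s => [_|a s IH /= /andP[as_ us]].
  rewrite big_nil (_ : [set _ | _] = set0); last by apply/seteqP; split.
  by rewrite /pr measure0.
rewrite (_ : [set _ | _] = f @^-1` [set a] `|` [set x | f x \in s]); last first.
  apply/seteqP; split=> x /=; rewrite inE; first by case/orP => [/eqP|]; [left|right].
  by case=> [->|->]; rewrite ?eqxx ?orbT.
rewrite big_cons pr_disjU ?IH //.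
  exact: (measurable_fibers_pred (fun t => t \in s)).
by apply/seteqP; split=> // x [/= -> h]; rewrite h in as_.
Qed.

Lemma pr_pred T (f : X -> T) (Q : pred T) : measurable_fibers f ->
  pr [set x | Q (f x)] = \sum_(t | Q t) law f t.
Proof.
move=> mf; have := law_seq mf (enum_uniq Q).
by under eq_set do rewrite mem_enum; move=> ->; rewrite big_enum.
Qed.

Lemma law_ge0 T (f : X -> T) t : 0 <= law f t.
Proof. exact: pr_ge0. Qed.

Lemma law_sum1 T (f : X -> T) : measurable_fibers f -> \sum_t law f t = 1.
Proof.
by move=> mf; rewrite -(pr_pred predT mf) -prT; congr pr; apply/seteqP; split.
Qed.

Lemma law_comp T U (f : X -> T) (h : T -> U) u : measurable_fibers f ->
  law (h \o f) u = \sum_(t | h t == u) law f t.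
Proof.
move=> mf; rewrite -(pr_pred (fun t => h t == u) mf); congr pr.
by apply/seteqP; split=> x /= /eqP.
Qed.

Lemma expect_comp T U (f : X -> T) (h : T -> U) (g : U -> R) :
  measurable_fibers f ->
  \sum_u law (h \o f) u * g u = \sum_t law f t * g (h t).
Proof.
move=> mf; rewrite [RHS](partition_big h predT) //=; apply: eq_bigr => u _.
by rewrite law_comp // mulr_suml; apply: eq_bigr => t /eqP ->.
Qed.

(** Transfers what holds pointwise on a set of full measure, such as positivity of matrix entries
    along points of [sft C], to the atoms of a law. *)
Lemma law_gt0 T (f : X -> T) Y t : measurable_fibers f -> measurable Y ->
  nu Y = 1%E -> 0 < law f t -> exists2 x, Y x & f x = t.
Proof.
move=> mf mY Y1; rewrite /law -(pr_setI_full mY Y1) // => h.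
have [[x [fx Yx]]|n0] := pselect ((f @^-1` [set t] `&` Y) !=set0).
  by exists x.
move: h; rewrite (_ : _ `&` _ = set0) ?/pr ?measure0 ?ltxx //.
by apply/seteqP; split=> // x hx; case: n0; exists x.
Qed.

End Law.

(** [g \o f] is a finite combination of indicators of fibers. For [f = edge] this turns the integral
    of [phiP] into a finite sum. *)
Lemma integral_finite_valued (d : measure_display) (X : measurableType d)
    (R : realType) (nu : probability X R) (T : finType) (f : X -> T)
    (g : T -> R) (Y : set X) :
  measurable_fibers f -> measurable Y -> nu Y = 1%E ->
  (\int[nu]_(x in Y) (g (f x))%:E = (\sum_t law nu f t * g t)%:E)%E.
Proof.
move=> mf mY Y1.
have intf t : nu.-integrable Y (fun x => (\1_(f @^-1` [set t]) x)%:E).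
  apply: (integrableS (measurableT)) => //.
  exact: integrable_indic.
under eq_integral => x _.
  rewrite (_ : g (f x) = \sum_t g t * \1_(f @^-1` [set t]) x); last first.
    rewrite (bigD1 (f x)) //= indicE mem_set // mulr1 big1 ?addr0 // => t tx.
    by rewrite indicE memNset ?mulr0 //= => fxt; rewrite fxt eqxx in tx.
  rewrite -sumEFin.
  over.
rewrite /= integral_sum //.
  rewrite -sumEFin; apply: eq_bigr => t _.
  under eq_integral do rewrite EFinM.
  rewrite integralZl // integral_indic //.
  transitivity ((g t)%:E * nu (f @^-1` [set t] `&` Y))%E; first by [].
  by rewrite prE ?pr_setI_full //; [rewrite -EFinM mulrC|exact: measurableI].
move=> t; under eq_fun do rewrite EFinM.
exact: integrableZl.
Qed.

(** * Measurability on the sequence space *)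

Section Space.
Variable n : nat.
Local Notation Sig := 'I_n.+1.
Local Notation Sp := (SpaceT n).
Implicit Types (x y : Sp).

Definition word (m : nat) (x : Sp) : m.-tuple Sig := [tuple x i | i < m].

Lemma nth_word m x i : (i < m)%N -> nth ord0 (word m x) i = x i.
Proof. by move=> im; rewrite -(tnth_nth ord0 _ (Ordinal im)) tnth_mktuple. Qed.

Lemma word_fiber m (w : m.-tuple Sig) : word m @^-1` [set w] = cyl w.
Proof.
apply/seteqP; split=> x /=.
  by move=> <- i; rewrite size_tuple => im; rewrite nth_word.
move=> h; apply: eq_from_tnth => i; rewrite tnth_mktuple h ?size_tuple //.
by rewrite -tnth_nth.
Qed.

Lemma measurable_cyl (w : seq Sig) : measurable (cyl w : set Sp).
Proof. by apply: sub_sigma_algebra; exists w. Qed.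

Lemma measurable_word m : measurable_fibers (word m).
Proof. by move=> w; rewrite word_fiber; exact: measurable_cyl. Qed.

Lemma measurable_coord i : measurable_fibers (fun x : Sp => x i).
Proof.
rewrite (_ : (fun _ => _) = (fun w : i.+1.-tuple Sig => tnth w ord_max) \o word i.+1).
  by apply: measurable_fibers_comp; exact: measurable_word.
by apply/funext => x /=; rewrite tnth_mktuple.
Qed.

Lemma iter_shiftE j x k : iter j (@shift n) x k = x (j + k)%N.
Proof. by elim: j k => //= j IH k; rewrite /shift IH addnS. Qed.

Lemma measurable_forallN (E : nat -> set Sp) :
  (forall i, measurable (E i)) -> measurable [set x | forall i, E i x].
Proof.
move=> mE; rewrite (_ : [set _ | _] = \bigcap_i E i).
  exact: bigcapT_measurable.
by apply/seteqP; split=> [x h i _|x h i]; [exact: h|exact: (h i)].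
Qed.

Lemma measurable_shift : measurable_fun setT (@shift n : Sp -> Sp).
Proof.
apply: (@measurability _ _ Sp Sp setT (@shift n) (@cylinders n)) => //.
move=> _ [_ [w ->] <-]; rewrite setTI.
rewrite (_ : _ @^-1` _ = [set x | forall i : 'I_(size w), x i.+1 = nth ord0 w i]).
  by apply: measurable_forall => i; exact: measurable_coord.
apply/seteqP; split=> x /= h i; first exact: h.
by move=> iw; exact: (h (Ordinal iw)).
Qed.

Lemma measurable_preimage_shift j (E : set Sp) :
  measurable E -> measurable (iter j (@shift n) @^-1` E : set Sp).
Proof.
elim: j E => //= j IH E mE.
apply: (IH (@shift n @^-1` E)); rewrite -[X in measurable X]setTI.
exact: measurable_shift.
Qed.

Lemma measurable_sft (R : realType) (C : 'M[R]_n.+1) : measurable (sft C).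
Proof.
apply: measurable_forallN => k.
have m2 := measurable_fibers_pair (measurable_coord k) (measurable_coord k.+1).
rewrite (_ : (fun _ => _) = [set x : Sp | C (x k, x k.+1).1 (x k, x k.+1).2 == 1]).
  exact: (measurable_fibers_pred (fun ij => C ij.1 ij.2 == 1) m2).
by apply/seteqP; split=> x /= /eqP.
Qed.

End Space.

(** * Approximation by cylinder sets *)

Section Approximation.
Variables (n : nat) (R : realType).
Local Notation Sp := (SpaceT n).
Implicit Types (x y : Sp) (E F : set Sp).

Definition sdiff E F : set Sp := [set x | ~ (E x <-> F x)].

Lemma sdiffE E F : sdiff E F = (E `\` F) `|` (F `\` E).
Proof.
apply/seteqP; split=> x /=; last by move=> [[]|[]] Hx nHx [h1 h2]; apply: nHx; auto.
move=> h; have [e|e] := pselect (E x); have [f|f] := pselect (F x).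
- by case: h.
- by left.
- by right.
- by case: h; split.
Qed.

Lemma measurable_sdiff E F :
  measurable E -> measurable F -> measurable (sdiff E F).
Proof.
by move=> mE mF; rewrite sdiffE; apply: measurableU; exact: measurableD.
Qed.

Definition local_set (L : nat) F :=
  forall x y, (forall i, (i < L)%N -> x i = y i) -> F x -> F y.

Lemma local_set_le L L' F : (L <= L')%N -> local_set L F -> local_set L' F.
Proof.
by move=> LL lF x y xy; apply: lF => i iL; apply: xy; exact: leq_trans LL.
Qed.

Lemma local_set_word L F : local_set L F ->
  exists Q : pred (L.-tuple 'I_n.+1), F = [set x | Q (word L x)].
Proof.
(* [nth] continues the word by [ord0]; locality makes the choice of continuation harmless. *)
move=> lF; exists (fun w => `[< F (fun i => nth ord0 w i) >]).
apply/seteqP; split=> x.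
  by move=> Fx; apply/asboolP; apply: lF Fx => i iL; rewrite nth_word.
by move/asboolP; apply: lF => i iL; rewrite nth_word.
Qed.

Lemma measurable_local_set L F : local_set L F -> measurable F.
Proof.
move=> /local_set_word[Q ->].
by have := measurable_fibers_pred Q (@measurable_word n L).
Qed.

Variable nu : probability Sp R.

Definition approximable E := measurable E /\
  forall e : R, 0 < e -> exists L F, local_set L F /\ pr nu (sdiff E F) < e.

Lemma approximableU E1 E2 :
  approximable E1 -> approximable E2 -> approximable (E1 `|` E2).
Proof.
move=> [m1 h1] [m2 h2]; split; first exact: measurableU.
move=> e e0; have e2 : 0 < e / 2 by lra.
have [L1 [F1 [l1 b1]]] := h1 _ e2; have [L2 [F2 [l2 b2]]] := h2 _ e2.
exists (maxn L1 L2), (F1 `|` F2).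
have l1' := local_set_le (leq_maxl L1 L2) l1.
have l2' := local_set_le (leq_maxr L1 L2) l2.
have lU : local_set (maxn L1 L2) (F1 `|` F2).
  by move=> x y xy [h|h]; [left; apply: l1' h|right; apply: l2' h].
split=> //.
have mF1 := measurable_local_set l1; have mF2 := measurable_local_set l2.
have mF := measurable_local_set lU.
apply: (@le_lt_trans _ _ (pr nu (sdiff E1 F1 `|` sdiff E2 F2))).
  apply: pr_mono.
  - by apply: measurable_sdiff => //; exact: measurableU.
  - by apply: measurableU; exact: measurable_sdiff.
  - move=> x h; have [h1x|] := pselect (E1 x <-> F1 x); last by left.
    have [h2x|] := pselect (E2 x <-> F2 x); last by right.
    by case: h; split=> -[/h1x|/h2x] ?; [left|right|left|right].
apply: le_lt_trans (prU _ _ _) _; [exact: measurable_sdiff|exact: measurable_sdiff|].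
lra.
Qed.

(** By continuity from below some [E k] has measure within [e / 2] of the union, and a local set
    approximates [E k] within [e / 2]. *)
Lemma approximable_cvg (E : (set Sp)^nat) :
  (forall i, approximable (E i)) -> {homo E : i j / (i <= j)%N >-> i `<=` j} ->
  approximable (\bigcup_i E i).
Proof.
move=> aE homoE; have mE i : measurable (E i) by case: (aE i).
have mU : measurable (\bigcup_i E i) by exact: bigcupT_measurable.
split=> // e e0; have e2 : 0 < e / 2 by lra.
have cv : pr nu (E i) @[i --> \oo] --> pr nu (\bigcup_i E i).
  apply: fine_cvg; rewrite -prE //.
  apply: nondecreasing_cvg_mu => // i j ij; exact/subsetPset/homoE.
have [k _ /(_ k (leqnn _))] := (cvgrPdist_lt _ _).1 cv _ e2.
have sub : E k `<=` \bigcup_i E i by move=> x; exists k.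
have -> : pr nu (\bigcup_i E i) = pr nu (E k) + pr nu (\bigcup_i E i `\` E k).
  rewrite -pr_disjU ?setDUK //; first exact: measurableD.
  by rewrite setDIK.
rewrite addrAC subrr add0r ger0_norm ?pr_ge0 // => bk.
have [_ /(_ _ e2)[L [F [lF bF]]]] := aE k.
exists L, F; split=> //.
have mF := measurable_local_set lF.
have mD : measurable (\bigcup_i E i `\` E k) by exact: measurableD.
apply: (@le_lt_trans _ _ (pr nu ((\bigcup_i E i `\` E k) `|` sdiff (E k) F))).
  apply: pr_mono.
  - exact: measurable_sdiff.
  - by apply: measurableU => //; exact: measurable_sdiff.
  - move=> x /= h; have [Ek|nEk] := pselect (E k x).
      by right=> hk; apply: h; split=> [_|/hk]; [exact/hk|exact: sub].
    have [Ux|nUx] := pselect ((\bigcup_i E i) x); first by left.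
    by right=> hk; apply: h; split=> // /hk.
apply: le_lt_trans (prU _ _ _) _ => //; first exact: measurable_sdiff.
lra.
Qed.

(** The approximable sets form a sigma-algebra containing the cylinders, which are themselves
    local. *)
Lemma measurable_approximable E : measurable E -> approximable E.
Proof.
suff h : <<s @cylinders n >> `<=` approximable by exact: h.
have aC A : approximable A -> approximable (~` A).
  move=> [mA h]; split; first exact: measurableC.
  move=> e e0; have [L [F [lF bF]]] := h _ e0; exists L, (~` F); split.
    by move=> x y xy nFx Fy; apply: nFx; apply: lF Fy => i iL; rewrite xy.
  rewrite (_ : sdiff _ _ = sdiff A F) //.
  apply/seteqP; split=> x /= hx hx'; apply: hx; split; rewrite /setC /= ?hx'//.
    by move=> Ax; apply: contrapT => nF; case: hx' => _ /(_ nF).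
  by move=> Ax; apply: contrapT => nF; case: hx' => /(_ nF).
have a0 : approximable set0.
  split=> // e e0; exists 0%N, set0; split=> //.
  rewrite (_ : sdiff _ _ = set0) ?/pr ?measure0 //.
  by apply/seteqP; split=> // x /= h; case: h.
apply: smallest_sub; first split=> //.
- by move=> A aA; rewrite setTD; exact: aC.
- move=> A aA.
  (* Finite partial unions make the sequence increasing, as [approximable_cvg] requires. *)
  rewrite (_ : \bigcup_i A i = \bigcup_i \big[setU/set0]_(j < i) A j); last first.
    apply/seteqP; split=> x [i _ Aix]; first by exists i.+1 => //; rewrite big_ord_recr; right.
    by move: Aix; rewrite -bigcup_mkord => -[j _ Ajx]; exists j.
  apply: approximable_cvg.
    by elim=> [|i IH]; rewrite ?big_ord0 // big_ord_recr; exact: approximableU.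
  move=> i j ij x; rewrite -!bigcup_mkord => -[k /= ki Akx]; exists k => //=.
  exact: leq_trans ij.
- move=> _ [w ->]; split; first exact: measurable_cyl.
  move=> e e0; exists (size w), (cyl w); split.
    by move=> x y xy h i iw; rewrite -xy // h.
  rewrite (_ : sdiff _ _ = set0) ?/pr ?measure0 //.
  by apply/seteqP; split=> // x /= h; case: h.
Qed.

End Approximation.

(** * Invariance tested on cylinders *)

Section Invariance.
Variables (n : nat) (R : realType).
Local Notation Sp := (SpaceT n).

(** Two cylinders are nested or disjoint, so together with the empty set they form a generating
    pi-system, on which a finite measure is determined. *)
Lemma shift_invariant_cyl (nu : probability Sp R) :
  (forall w, nu (@shift n @^-1` cyl w) = nu (cyl w)) -> shift_invariant nu.
Proof.
move=> inv E mE.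
pose G := [set C : set Sp | C = set0 \/ exists w, C = cyl w].
have mG C : G C -> measurable C.
  by case=> [->|[w ->]]; [exact: measurable0|exact: measurable_cyl].
have cylI (v w : seq 'I_n.+1) : (size v <= size w)%N -> G (cyl v `&` cyl w).
  move=> vw; have [[x [xv xw]]|n0] := pselect (cyl v `&` cyl w !=set0).
    right; exists w; apply/seteqP; split=> y /=; first by case.
    move=> yw; split=> // i iv; rewrite yw ?(leq_trans iv) // -xw ?(leq_trans iv) //.
    exact: xv.
  by left; apply/seteqP; split=> // x hx; case: n0; exists x.
have sG : setI_closed G.
  move=> A B [->|[v ->]]; first by rewrite set0I; left.
  move=> [->|[w ->]]; first by rewrite setI0; left.
  by have [vw|/ltnW wv] := leqP (size v) (size w); [|rewrite setIC]; exact: cylI.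
have GT : G setT.
  by right; exists [::]; apply/seteqP; split.
(* The image of [nu] under the shift, to be identified with [nu]. *)
pose m2 : probability Sp R := distribution nu (mfun_Sub (mem_set (@measurable_shift n))).
have cov : \bigcup_(_ in [set: nat]) [set: Sp] = setT.
  by apply: bigcup_const; exists 0%N.
apply: (@g_sigma_algebra_measure_unique _ R Sp G mG (fun=> setT) (fun=> GT) cov m2 nu sG).
- move=> A [->|[w ->]]; first by rewrite !measure0.
  exact: inv.
- suff h : (m2 setT < +oo)%E by [].
  by rewrite probability_setT ltry.
- apply: sub_smallest2r mE; first exact: smallest_sigma_algebra.
  by move=> _ [w ->]; right; exists w.
Qed.

End Invariance.

(** * Markov measures by interval coding *)

Section MarkovCoding.
Variables (n : nat) (R : realType).
Local Notation Sig := 'I_n.+1.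
Local Notation Sp := (SpaceT n).
Implicit Types (r : Sig -> R) (u : R) (i j a b : Sig).

Definition cum r (k : nat) : R := \sum_(j < n.+1 | (j < k)%N) r j.

Lemma cum0 r : cum r 0 = 0.
Proof. exact: big_pred0. Qed.

Lemma cumS r i : cum r i.+1 = cum r i + r i.
Proof.
rewrite /cum (bigD1 i) ?ltnSn //= addrC; congr (_ + _); apply: eq_bigl => j.
by rewrite ltnS (ltn_neqAle j i) andbC.
Qed.

Definition distr r := (forall i, 0 <= r i) /\ \sum_i r i = 1.

Lemma cum_le r k l : distr r -> (k <= l)%N -> cum r k <= cum r l.
Proof.
move=> [r0 _] kl; rewrite /cum big_mkcond [leRHS]big_mkcond /=.
apply: ler_sum => j _; case: ifPn => [jk|_]; first by rewrite (leq_trans jk kl).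
by case: ifP.
Qed.

Lemma cum_le1 r k : distr r -> cum r k <= 1.
Proof.
move=> [r0 <-]; rewrite /cum big_mkcond /=.
by apply: ler_sum => j _; case: ifP.
Qed.

Lemma cum_full r : distr r -> cum r n.+1 = 1.
Proof. by move=> [_ <-]; apply: eq_bigl => j; rewrite ltn_ord. Qed.

Definition in_slot r u i := (cum r i <= u) && (u < cum r i.+1).

(** For a distribution [r] the default [ord0] is reached only when [u] lies outside the unit
    interval. *)
Definition slot r u : Sig := odflt ord0 [pick i | in_slot r u i].

Lemma in_slot_slot r u : distr r -> 0 <= u < 1 -> in_slot r u (slot r u).
Proof.
move=> dr /andP[u0 u1]; rewrite /slot; case: pickP => //= none; exfalso.
have h k : (k <= n.+1)%N -> cum r k <= u.
  elim: k => [|k IH] kn; first by rewrite cum0.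
  have /negbT := none (Ordinal kn); rewrite /in_slot /= IH ?(ltnW kn) //.
  by rewrite -leNgt.
by have := h n.+1 (leqnn _); rewrite cum_full // leNgt u1.
Qed.

Lemma slotP r u i : distr r -> 0 <= u < 1 -> slot r u = i <-> in_slot r u i.
Proof.
move=> dr u01; split=> [<-|]; first exact: in_slot_slot.
have := in_slot_slot dr u01; set j := slot r u => /andP[j1 j2] /andP[i1 i2].
apply/val_inj; case: (ltngtP j i) => // ij.
  by exfalso; have := cum_le dr ij; lra.
by exfalso; have := cum_le dr ij; lra.
Qed.

Variable T : 'M[R]_n.+1.
Hypothesis T_distr : forall i, distr (T i).

(* Each digit selects a subinterval of [0, 1), which is then rescaled to [0, 1). *)
Fixpoint code r u (k : nat) : Sig :=
  let i := slot r u in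
  if k is k'.+1 then code (T i) ((u - cum r i) / r i) k' else i.

Lemma cyl_code_cons r u a (ws : seq Sig) :
  cyl (a :: ws) (code r u) <->
  slot r u = a /\ cyl ws (code (T a) ((u - cum r a) / r a)).
Proof.
split=> [h|[sa h]].
  have sa : slot r u = a by exact: (h 0%N).
  by split=> // i iw; have := h i.+1 iw; rewrite /= sa.
by case=> [|i] //= iw; rewrite sa; exact: h.
Qed.

(** Induction on the word: the interval of the remaining letters, coded with the row [T a], is
    mapped affinely onto a part of the slot of [a], which multiplies its length by [r a]. *)
Lemma code_itv r a (ws : seq Sig) : distr r ->
  exists al, let l := r a * chainprod T a ws in
  [/\ 0 <= al, 0 <= l, al + l <= 1 & forall u, 0 <= u < 1 ->
    (cyl (a :: ws) (code r u) <-> al <= u < al + l)].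
Proof.
elim: ws r a => [|b ws IH] r a dr /=.
  exists (cum r a); rewrite mulr1 -cumS; split.
  - by rewrite -(cum0 r); exact: cum_le.
  - by case: dr.
  - exact: cum_le1.
  - move=> u u01; rewrite cyl_code_cons -(slotP _ dr u01); split=> [[]//|sa].
    by split.
have [al [al0 l0 all1 H]] := IH (T a) b (T_distr a).
set l := T a b * _ in l0 all1 H *.
have ra : 0 <= r a by case: dr.
have ca : 0 <= cum r a by rewrite -(cum0 r); exact: cum_le.
exists (cum r a + r a * al); split.
- by rewrite addr_ge0 // mulr_ge0.
- by rewrite mulr_ge0.
- rewrite -addrA -mulrDr; apply: le_trans (cum_le1 a.+1 dr).
  by rewrite cumS lerD2l ler_piMr.
move=> u u01; rewrite cyl_code_cons (slotP _ dr u01) /in_slot cumS.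
(* An empty slot: both sides are false, and the rescaling by [r a] is never inverted. *)
have [r0|rn0] := eqVneq (r a) 0.
  by rewrite r0 !mul0r !addr0; split=> [[]|]; move=> /andP[]; lra.
have rp : 0 < r a by rewrite lt_neqAle eq_sym rn0.
set v := (u - cum r a) / r a.
have uv : u = cum r a + r a * v by rewrite /v mulrCA divff // mulr1 addrC subrK.
have E1 x : (cum r a + r a * x <= u) = (x <= v) by rewrite uv lerD2l ler_pM2l.
have E2 x : (u < cum r a + r a * x) = (v < x) by rewrite uv ltrD2l ltr_pM2l.
rewrite -addrA -mulrDr E1 E2.
have := E1 0; rewrite mulr0 addr0 => ->; have := E2 1; rewrite mulr1 => ->.
split=> [[v01 hv]|hv]; first exact/H.
have v01 : 0 <= v < 1 by move: hv => /andP[]; lra.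
by split=> //; apply/H.
Qed.

Lemma cyl0 : cyl [::] = [set: Sp].
Proof. by apply/seteqP; split. Qed.

(** The constant sequence outside the unit interval makes the map total; Lebesgue measure restricted
    to that interval gives those points no mass. *)
Let coding r u : Sp := if (0 <= u < 1) then code r u else fun=> ord0.

Let preimage_coding r (w : seq Sig) : distr r ->
  measurable (coding r @^-1` cyl w).
Proof.
move=> dr.
have mI : measurable (`[0, 1[ : set R) by exact: measurable_itv.
rewrite -[X in measurable X](setIT) -(setUCr `[0, 1[%classic) setIUr.
apply: measurableU.
  case: w => [|a ws]; first by rewrite cyl0 preimage_setT setTI.
  have [al [al0 l0 l1 H]] := code_itv a ws dr.
  rewrite (_ : _ `&` _ = `[al, al + r a * chainprod T a ws[%classic) //.
  apply/seteqP; split=> u /=; rewrite !in_itv /= /coding.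
    by move=> [+ u01]; rewrite u01 H.
  move=> hu; have u01 : 0 <= u < 1 by move: hu => /andP[]; lra.
  by rewrite u01; split=> //; apply/H.
have [h|h] := pselect (cyl w (fun=> ord0)).
  rewrite (_ : _ `&` _ = ~` `[0, 1[%classic); first exact: measurableC.
  apply/seteqP; split=> u /=; rewrite in_itv /= /coding; first by case.
  by move=> nu; split=> //; case: ifP nu.
rewrite (_ : _ `&` _ = set0) //; apply/seteqP; split=> u //=.
by rewrite in_itv /= /coding => -[+ nu]; case: ifP nu.
Qed.

Lemma markov_measure_exists (p : 'rV[R]_n.+1) : distr (p 0) ->
  exists nu : probability Sp R, is_markov_measure T p nu.
Proof.
move=> dp.
have mI : measurable (`[0, 1[ : set R) by exact: measurable_itv.
pose leb := mrestr (@lebesgue_measure R) mI.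
have leb1 : leb setT = 1%E.
  by rewrite /leb /mrestr setTI lebesgue_measure_itv /= lte_fin ltr01 sube0.
pose B := Measure_isProbability.Build _ _ _ leb leb1.
pose P : probability (measurableTypeR R) R := HB.pack leb B.
have mc : @measurable_fun _ _ (measurableTypeR R) Sp setT (coding (p 0)).
  apply: (@measurability _ _ _ Sp setT (coding (p 0)) (@cylinders n)) => //.
  by move=> _ [_ [w ->] <-]; rewrite setTI; exact: preimage_coding.
pose X := @mfun_Sub _ _ (measurableTypeR R) Sp (coding (p 0)) (mem_set mc).
exists (distribution P X) => a ws.
have [al [al0 l0 l1 H]] := code_itv a ws dp.
rewrite /distribution /pushforward /= /leb /mrestr.
rewrite (_ : _ `&` _ = `[al, al + p 0 a * chainprod T a ws[%classic).
  rewrite lebesgue_measure_itv /= lte_fin.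
  case: ltP => h; first by rewrite -EFinB addrC addKr.
  by congr EFin; lra.
apply/seteqP; split=> u /=; rewrite !in_itv /= /coding.
  by move=> [+ u01]; rewrite u01 H.
move=> hu; have u01 : 0 <= u < 1 by move: hu => /andP[]; lra.
by rewrite u01; split=> //; apply/H.
Qed.

End MarkovCoding.

(** * The upper bound for entropy *)

Section UpperBound.
Variables (n : nat) (R : realType).
Local Notation Sig := 'I_n.+1.
Local Notation Sp := (SpaceT n).

Section Labels.
Variable nu : probability Sp R.

Lemma pr_exists_le (I : finType) (E : I -> set Sp) :
  (forall i, measurable (E i)) ->
  pr nu [set x | exists i, E i x] <= \sum_i pr nu (E i).
Proof.
move=> mE; rewrite (_ : [set _ | _] = \big[setU/set0]_(i in predT) E i); last first.
  rewrite -bigcup_pred.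
  by apply/seteqP; split=> x [i]; [exists i|move=> Ei; exists i].
suff [] : measurable (\big[setU/set0]_(i in predT) E i) /\
  pr nu (\big[setU/set0]_(i in predT) E i) <= \sum_(i in predT) pr nu (E i) by [].
elim/big_rec2: _ => [|i y U _ [mU IH]].
  by split; [exact: measurable0|rewrite /pr measure0].
split; first exact: measurableU.
by apply: le_trans (prU nu _ _) _ => //; rewrite lerD2l.
Qed.

(** Each label class is approximated by a local set, all with one common length [L]. The guess picks
    a class whose local set contains the word; it can fail only on one of the [k] symmetric
    differences. *)
Lemma approximate_label k (lab : Sp -> 'I_k) (e : R) :
  measurable_fibers lab -> 0 < e ->
  exists L (c : L.-tuple Sig -> 'I_k),
    pr nu [set x | c (word L x) != lab x] < e.
Proof.
move=> mlab e0.
have k0 : (0 < k)%N by case: k lab mlab => [|//] lab _; case: (lab point).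
(* The [k] errors then add up to at most [e / 2], strictly below [e]. *)
pose e' := e / k%:R / 2.
have kp : 0 < k%:R :> R by rewrite ltr0n.
have e'0 : 0 < e' by rewrite !divr_gt0.
have /choice[LF LFP] : forall i, exists LF : nat * set Sp,
    local_set LF.1 LF.2 /\ pr nu (sdiff (lab @^-1` [set i]) LF.2) < e'.
  move=> i; have [_ /(_ _ e'0)[L [F h]]] := measurable_approximable nu (mlab i).
  by exists (L, F).
pose L := \max_i (LF i).1.
have lL i : local_set L (LF i).2.
  by apply: local_set_le (LFP i).1; exact: leq_bigmax.
have /choice[Q QP] : forall i, exists Q : pred (L.-tuple Sig),
  (LF i).2 = [set x | Q (word L x)] by move=> i; exact: local_set_word.
exists L, (fun w => odflt (lab point) [pick i | Q i w]).
set B := [set x | _].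
pose D i := sdiff (lab @^-1` [set i]) (LF i).2.
have mD i : measurable (D i).
  by apply: measurable_sdiff => //; exact: measurable_local_set (lL i).
have sub : B `<=` [set x | exists i, D i x].
  move=> x /= Bx; apply: contrapT => nD.
  have h i : lab x = i <-> Q i (word L x).
    apply: contrapT => nh; apply: nD; exists i => h; apply: nh.
    by move: h; rewrite QP.
  move/negP: Bx; apply; case: pickP => [i|] /=; first by move/h => ->.
  by move=> /(_ (lab x)); rewrite (h (lab x)).1.
have mB : measurable B.
  have mp := measurable_fibers_pair (@measurable_word n L) mlab.
  exact: (measurable_fibers_pred (fun wi => odflt (lab point) [pick i | Q i wi.1] != wi.2) mp).
apply: (@le_lt_trans _ _ (\sum_i pr nu (D i))).
  apply: le_trans (pr_exists_le mD); apply: pr_mono => //.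
  rewrite (_ : [set _ | _] = \big[setU/set0]_(i in predT) D i); last first.
    rewrite -bigcup_pred.
    by apply/seteqP; split=> x [i]; [exists i|move=> Ei; exists i].
  exact: bigsetU_measurable.
apply: (@le_lt_trans _ _ (\sum_(i < k) e')).
  by apply: ler_sum => i _; exact/ltW/(LFP i).2.
rewrite sumr_const card_ord -[ltLHS]mulr_natl /e' (_ : _ * _ = e / 2); first by lra.
by field; rewrite gt_eqF.
Qed.

Lemma law_shift (T : finType) (f : Sp -> T) j : shift_invariant nu ->
  measurable_fibers f -> law nu (f \o iter j (@shift n)) = law nu f.
Proof.
move=> inv mf; apply/funext => t; rewrite /law /pr; congr fine.
rewrite comp_preimage; move: (mf t); move: (f @^-1` _) => E.
elim: j E => //= j IH E mE.
rewrite -(inv _ mE) -(IH (@shift n @^-1` E)) //.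
exact: (@measurable_preimage_shift n 1 E mE).
Qed.

Lemma measurable_fibers_shift (T : finType) (f : Sp -> T) j :
  measurable_fibers f -> measurable_fibers (f \o iter j (@shift n) : Sp -> T).
Proof. by move=> mf t; rewrite comp_preimage; exact: measurable_preimage_shift. Qed.

End Labels.

Definition itinerary k (lab : Sp -> 'I_k) m (x : Sp) : {ffun 'I_m -> 'I_k} :=
  [ffun j : 'I_m => lab (iter j (@shift n) x)].

Lemma measurable_itinerary k (lab : Sp -> 'I_k) m :
  measurable_fibers lab -> measurable_fibers (itinerary lab m).
Proof.
move=> mlab; apply: measurable_fibers_ffun => j.
exact: (measurable_fibers_shift j mlab).
Qed.

Definition edge (x : Sp) : Sig * Sig := (x 0%N, x 1%N).

Lemma measurable_edge : measurable_fibers edge.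
Proof. by apply: measurable_fibers_pair; exact: measurable_coord. Qed.

(* The subprobability kernel of a [k]-ary symmetric channel with small error:
   its diagonal costs [d / 2] in the Gibbs inequality. *)
Let chan k (d : R) (a i : 'I_k) : R :=
  if a == i then expR (- (d / 2)) else (1 - expR (- (d / 2))) / k%:R.

Let chan_gt0 k (d : R) (a i : 'I_k) : 0 < d -> 0 < chan d a i.
Proof.
move=> d0; rewrite /chan; case: ifP => _; first exact: expR_gt0.
rewrite divr_gt0 ?ltr0n ?(leq_ltn_trans _ (ltn_ord a)) // subr_gt0 expR_lt1; lra.
Qed.

Let chan_sum k (d : R) (a : 'I_k) : 0 < d -> \sum_i chan d a i <= 1.
Proof.
move=> d0; rewrite (bigD1 a) //= {1}/chan eqxx.
have e1 : 0 <= 1 - expR (- (d / 2)).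
  by rewrite subr_ge0 ltW // expR_lt1; lra.
have kp : 0 < k%:R :> R by rewrite ltr0n (leq_ltn_trans _ (ltn_ord a)).
rewrite addrC -lerBrDr.
apply: (@le_trans _ _ (\sum_(i < k) (1 - expR (- (d / 2))) / k%:R)).
  rewrite [leRHS](bigD1 a) //= -[leLHS]add0r lerD ?divr_ge0 //.
  by apply: ler_sum => i ia; rewrite /chan eq_sym (negbTE ia).
by rewrite sumr_const card_ord -[leLHS]mulr_natl mulrCA divff ?mulr1 // gt_eqF.
Qed.

Variables (C M : 'M[R]_n.+1).
Hypothesis M0 : forall i j, 0 <= M i j.
Hypothesis MC : forall i j, C i j = 1 -> 0 < M i j.

Lemma wt_word_gt0 m (x : Sp) : sft C x -> 0 < wt M (word m.+1 x).
Proof.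
move=> Cx; rewrite wtE; apply: prodr_gt0 => j _.
by rewrite !nth_word ?ltnS ?(ltnW (ltn_ord j)) //; apply: MC; exact: Cx.
Qed.

Lemma Z_gt0 m (x : Sp) : sft C x -> 0 < Z M m.
Proof.
move=> Cx; rewrite -sum_wt (bigD1 (word m.+1 x)) //=.
rewrite ltr_pwDl ?wt_word_gt0 //; apply: sumr_ge0 => w _; exact: wt_ge0.
Qed.

(** [gibbs_marginal] is applied to the joint law of the itinerary and the word with [m + L] edges,
    projected to the itinerary. The extra [L] letters let the guess be evaluated at all [m] times.
    By invariance each edge contributes the same expected logarithm, and each channel use costs at
    most [d]. *)
Lemma entropy_upper (nu : probability Sp R) k (lab : Sp -> 'I_k) (d : R) :
  nu (sft C) = 1%E -> shift_invariant nu -> measurable_fibers lab -> 0 < d ->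
  exists L, forall m,
    \sum_s eta (law nu (itinerary lab m) s) +
      (m + L)%:R * (\sum_ij law nu edge ij * ln (M ij.1 ij.2))
    <= ln (Z M (m + L)) + m%:R * d.
Proof.
move=> C1 inv mlab d0.
(* [K] is the cost of a wrong guess. With error probability below [e], wrong guesses add at most
   [d / 2] per step to the diagonal cost [d / 2]. *)
pose K := - ln ((1 - expR (- (d / 2))) / k%:R : R).
pose e := d / 2 / (`|K| + 1).
have K1 : 0 < `|K| + 1 by rewrite ltr_pwDr.
have e0 : 0 < e by rewrite !divr_gt0.
have [L [c hc]] := approximate_label nu mlab e0.
exists L => m.
pose N := (m + L)%N.
pose f (x : Sp) := (itinerary lab m x, word N.+1 x).
have mf : measurable_fibers f.
  by apply: measurable_fibers_pair; [exact: measurable_itinerary|exact: measurable_word].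
pose T := ({ffun 'I_m -> 'I_k} * N.+1.-tuple Sig)%type.
(* The guess of the label at time [j], read off the [L] letters starting at position [j]. *)
pose lc (w : N.+1.-tuple Sig) (j : 'I_m) := c [tuple nth ord0 w (j + i) | i < L].
pose tau (t : T) := wt M t.2 / Z M N * \prod_j chan d (lc t.2 j) (t.1 j).
have [x0 Cx0] : exists x0, sft C x0.
  have [//|n0] := pselect (exists x0, sft C x0).
  have C0 : sft C = set0 by apply/seteqP; split=> // x Cx; case: n0; exists x.
  by move: C1; rewrite C0 measure0 => /eqP; rewrite eq_sym onee_eq0.
have ZN : 0 < Z M N by exact: (Z_gt0 _ Cx0).
have tau0 t : 0 <= tau t.
  rewrite mulr_ge0 ?divr_ge0 ?wt_ge0 ?(ltW ZN) //.
  by apply: prodr_ge0 => j _; rewrite ltW // chan_gt0.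
have tau1 : \sum_t tau t <= 1.
  rewrite -(pair_bigA_idem _ (fun s w => tau (s, w))) //= ?addr0 // exchange_big /=.
  apply: (@le_trans _ _ (\sum_(w : N.+1.-tuple Sig) wt M w / Z M N)).
    apply: ler_sum => w _; rewrite /tau /= -mulr_sumr ler_piMr ?divr_ge0 ?wt_ge0 ?(ltW ZN) //.
    (* The sum over itineraries factors into channel row sums, one for each time. *)
    rewrite -(bigA_distr_bigA (fun j i => chan d (lc w j) i)) /=.
    apply: prodr_ile1 => j _; rewrite chan_sum // andbT.
    by apply: sumr_ge0 => i _; rewrite ltW // chan_gt0.
  by rewrite -mulr_suml sum_wt divff // gt_eqF.
have Mpos t j : 0 < law nu f t -> (j < N)%N ->
    0 < M (nth ord0 t.2 j) (nth ord0 t.2 j.+1).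
  move=> /(law_gt0 mf (measurable_sft C) C1)[x Cx <-] jN /=.
  by rewrite !nth_word ?ltnS ?(ltnW jN) //; apply: MC; exact: Cx.
have taupos t : 0 < law nu f t -> 0 < tau t.
  move=> lt; rewrite mulr_gt0 ?divr_gt0 //.
    by rewrite wtE; apply: prodr_gt0 => j _; exact: Mpos.
  by apply: prodr_gt0 => j _; exact: chan_gt0.
have := gibbs_marginal (@fst _ _) (law_ge0 nu f) (law_sum1 nu mf) tau0 tau1 taupos.
under eq_bigr do rewrite -(law_comp nu (@fst _ _) _ mf).
rewrite -/(itinerary lab m).
move=> /le_trans; rewrite -lerBrDr; apply.
have ltau t : law nu f t * ln (tau t) =
    law nu f t * \sum_(j < N) ln (M (nth ord0 t.2 j) (nth ord0 t.2 j.+1))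
    - law nu f t * ln (Z M N)
    + law nu f t * \sum_j ln (chan d (lc t.2 j) (t.1 j)).
  (* Outside the support [tau t] may vanish, and its logarithm need not split. *)
  have [->|ln0] := eqVneq (law nu f t) 0; first by rewrite !mul0r; ring.
  have lt : 0 < law nu f t by rewrite lt_neqAle eq_sym ln0 law_ge0.
  have w0 : 0 < wt M t.2 by rewrite wtE; apply: prodr_gt0 => j _; exact: Mpos.
  rewrite -mulrBr -mulrDr; congr (_ * _).
  rewrite /tau lnM ?posrE ?divr_gt0 //; last by apply: prodr_gt0 => j _; exact: chan_gt0.
  rewrite ln_div ?posrE // ln_prod; last by move=> j; exact: chan_gt0.
  by rewrite wtE ln_prod // => j; exact: Mpos.
under eq_bigr do rewrite ltau.
rewrite big_split /= sumrB -mulr_suml law_sum1 // mul1r.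
have -> : \sum_t law nu f t * (\sum_(j < N) ln (M (nth ord0 t.2 j) (nth ord0 t.2 j.+1)))
    = N%:R * \sum_ij law nu edge ij * ln (M ij.1 ij.2).
  under eq_bigr do rewrite mulr_sumr.
  rewrite exchange_big /= -[N in N%:R]card_ord mulr_natl -sumr_const.
  apply: eq_bigr => j _.
  rewrite -(expect_comp nu (fun t : T => (nth ord0 t.2 j, nth ord0 t.2 j.+1))
    (fun ij => ln (M ij.1 ij.2)) mf).
  rewrite -(law_shift j inv measurable_edge); apply: eq_bigr => ij _.
  congr (law _ _ _ * _); apply/funext => x /=; rewrite /edge !iter_shiftE addn0 addn1.
  by rewrite !nth_word ?ltnS ?(ltnW (ltn_ord j)).
have B : - (m%:R * d) <= \sum_t law nu f t * (\sum_j ln (chan d (lc t.2 j) (t.1 j))).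
  under eq_bigr do rewrite mulr_sumr.
  rewrite exchange_big /= -[m in m%:R]card_ord mulr_natl -sumr_const -sumrN.
  apply: ler_sum => j _.
  pose g (x : Sp) := (c (word L x), lab x).
  have mg : measurable_fibers g.
    apply: measurable_fibers_pair => //.
    exact: (measurable_fibers_comp c (@measurable_word n L)).
  rewrite -(expect_comp nu (fun t : T => (lc t.2 j, t.1 j))
    (fun ai => ln (chan d ai.1 ai.2)) mf).
  have -> : (fun t : T => (lc t.2 j, t.1 j)) \o f = g \o iter j (@shift n).
    apply/funext => x /=; rewrite /g ffunE /lc; congr (c _, _).
    apply: eq_from_tnth => i; rewrite !tnth_mktuple iter_shiftE nth_word //.
    by rewrite ltnS (leq_trans (leq_add (ltnW (ltn_ord j)) (ltnW (ltn_ord i)))).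
  rewrite law_shift //.
  apply: (@le_trans _ _ (\sum_ai law nu g ai * (- (d / 2) - `|K| * (ai.1 != ai.2)%:R))).
    under eq_bigr do rewrite mulrBr mulrCA.
    rewrite sumrB -mulr_suml law_sum1 // mul1r -mulr_sumr.
    have -> : \sum_ai law nu g ai * (ai.1 != ai.2)%:R = pr nu [set x | c (word L x) != lab x].
      rewrite -[RHS]/(pr nu [set x | (g x).1 != (g x).2]).
      rewrite (pr_pred nu (fun ai => ai.1 != ai.2) mg) [RHS]big_mkcond /=.
      by apply: eq_bigr => ai _; case: ifP; rewrite ?mulr1 ?mulr0.
    set q := pr _ _ in hc *.
    have : `|K| * q <= d / 2.
      apply: (@le_trans _ _ ((`|K| + 1) * e)).
        by apply: ler_pM => //; [exact: pr_ge0|rewrite lerDl|exact: ltW].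
      by rewrite /e mulrCA divff ?mulr1 // gt_eqF.
    lra.
  apply: ler_sum => -[a i] _ /=; rewrite ler_wpM2l ?law_ge0 // /chan.
  case: eqVneq => _ /=; first by rewrite expRK mulr0 subr0.
  rewrite mulr1; have : K <= `|K| by exact: ler_norm.
  rewrite /K; move: (ln _) => z; lra.
rewrite -/N; set I := \sum_ij _ in B *; set S := \sum_t _ in B *; lra.
Qed.

End UpperBound.

(** * Entropy of Markov measures *)

Section PartitionEntropy.
Variables (n : nat) (R : realType) (nu : probability (SpaceT n) R).

Lemma part_entropyE k (al : 'I_k -> set (SpaceT n)) (lab : SpaceT n -> 'I_k) m :
  (forall i, al i = lab @^-1` [set i]) ->
  part_entropy nu al m = \sum_s eta (law nu (itinerary lab m) s).
Proof.
move=> E; apply: eq_bigr => s _; congr (eta (fine (nu _))).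
apply/seteqP; split=> x /=.
  by move=> h; apply/ffunP => j; rewrite ffunE; have := h j; rewrite E.
by move=> <- j; rewrite E ffunE.
Qed.

Lemma partition_label k (al : 'I_k -> set (SpaceT n)) : is_partition al ->
  exists2 lab : SpaceT n -> 'I_k,
    measurable_fibers lab & forall i, al i = lab @^-1` [set i].
Proof.
move=> [mal [dis /choice[lab labP]]].
have E i : al i = lab @^-1` [set i].
  apply/seteqP; split=> x /=; last by move=> <-.
  move=> ax; apply/eqP; apply: contrapT => /negP ne.
  by have := dis _ _ ne => /seteqP[/(_ x (conj (labP x) ax))].
by exists lab => // i; rewrite -E.
Qed.

Lemma entropy_itinerary_word m :
  \sum_s eta (law nu (itinerary (fun x : SpaceT n => x 0%N) m) s) =
  \sum_w eta (law nu (word m) w).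
Proof.
rewrite (reindex (fun w : m.-tuple 'I_n.+1 => [ffun i => tnth w i])) /=; last first.
  exists (fun s : {ffun 'I_m -> 'I_n.+1} => [tuple s i | i < m]) => [w _|s _].
    by apply: eq_from_tnth => i; rewrite tnth_mktuple ffunE.
  by apply/ffunP => i; rewrite ffunE tnth_mktuple.
apply: eq_bigr => w _; congr (eta (pr _ _)).
apply/seteqP; split=> x /=.
  move=> /ffunP h; apply: eq_from_tnth => i; rewrite tnth_mktuple.
  by have := h i; rewrite !ffunE iter_shiftE addn0.
by move=> <-; apply/ffunP => i; rewrite !ffunE tnth_mktuple iter_shiftE addn0.
Qed.

End PartitionEntropy.

Section MarkovMeasure.
Variables (n : nat) (R : realType).
Local Notation Sig := 'I_n.+1.
Local Notation Sp := (SpaceT n).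
Variables (T : 'M[R]_n.+1) (p : 'rV[R]_n.+1) (nu : probability Sp R).
Hypothesis nuM : is_markov_measure T p nu.

Lemma law_word m (w : m.+1.-tuple Sig) :
  law nu (word m.+1) w = p 0 (thead w) * wt T w.
Proof.
have Ew : tval w = thead w :: behead w by rewrite [in LHS](tuple_eta w).
by rewrite /law word_fiber /pr Ew nuM.
Qed.

Lemma law_edge ij : law nu (@edge n) ij = p 0 ij.1 * T ij.1 ij.2.
Proof.
rewrite /law (_ : _ @^-1` _ = cyl [:: ij.1; ij.2]).
  by rewrite /pr nuM /= mulr1.
apply/seteqP; split=> x /=; first by move=> <- [|[|]].
by move=> h; rewrite /edge (h 0%N) // (h 1%N) //; case: ij {h}.
Qed.

Hypothesis pT : p *m T = p.

(** The preimage of a cylinder is an event on words with one more letter in front; summing over that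
    letter uses [p *m T = p]. *)
Lemma markov_shift_invariant : shift_invariant nu.
Proof.
apply: shift_invariant_cyl => -[|a ws]; first by rewrite cyl0 preimage_setT.
pose m := (size ws).+1; pose w : m.-tuple Sig := [tuple of a :: in_tuple ws].
rewrite (_ : _ @^-1` _ = [set x | [tuple of behead (word m.+1 x)] == w]); last first.
  apply/seteqP; split=> x /=.
    move=> h; apply/eqP; apply: eq_from_tnth => i.
    rewrite !(tnth_nth ord0) nth_behead nth_word; last exact: (ltn_ord i).
    exact: (h i (ltn_ord i)).
  move=> /eqP h i iw; rewrite -[a :: ws]/(tval w) -h nth_behead nth_word //.
have mw := @measurable_word n m.+1.
have mE := measurable_fibers_pred (fun v : m.+1.-tuple Sig => [tuple of behead v] == w) mw.
rewrite (prE nu mE) nuM; congr EFin.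
rewrite (pr_pred nu (fun v : m.+1.-tuple Sig => [tuple of behead v] == w) mw).
rewrite big_mkcond big_tuple_cons /=.
have -> : p 0 a * chainprod T a ws = \sum_b p 0 b * (T b a * chainprod T a ws).
  by rewrite -{1}pT mxE mulr_suml; apply: eq_bigr => b _; rewrite mulrA.
apply: eq_bigr => b _.
rewrite (bigD1 w) //= [X in _ + X]big1 ?addr0 => [|t tw].
  rewrite ifT; last by apply/eqP/val_inj.
  by rewrite law_word theadE.
by rewrite ifF //; apply: contraNF tw => /eqP <-; apply/eqP/val_inj.
Qed.

Hypothesis p0 : forall i, 0 <= p 0 i.
Hypothesis T0 : forall i j, 0 <= T i j.

(** A forbidden edge is null at time 0, hence at every time by invariance, and the complement of
    [sft C] is the countable union of these events. *)
Lemma markov_sft_full (C : 'M[R]_n.+1) :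
  (forall i j, 0 < p 0 i * T i j -> C i j = 1) -> nu (sft C) = 1%E.
Proof.
move=> sC.
pose F k := [set x : Sp | C (x k) (x k.+1) != 1].
have FE k : F k = [set x : Sp | (fun ij => C ij.1 ij.2 != 1) ((@edge n \o iter k (@shift n)) x)].
  by apply/seteqP; split=> x /=; rewrite /edge !iter_shiftE addn0 addn1.
have me k : measurable_fibers (@edge n \o iter k (@shift n) : Sp -> _).
  exact: (measurable_fibers_shift k (@measurable_edge n)).
have mF k : measurable (F k).
  by rewrite FE; exact: (measurable_fibers_pred (fun ij => C ij.1 ij.2 != 1) (me k)).
have F0 k : nu (F k) = 0%E.
  rewrite prE // FE (pr_pred nu (fun ij => C ij.1 ij.2 != 1) (me k)).
  rewrite (law_shift k markov_shift_invariant (@measurable_edge n)) big1 // => ij.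
  rewrite law_edge; apply: contraNeq => h; apply/eqP/sC.
  by rewrite lt_neqAle eq_sym h mulr_ge0.
have -> : sft C = ~` (\bigcup_k F k).
  apply/seteqP; split=> x.
    by move=> Cx [k _]; rewrite /F /= Cx eqxx.
  by move=> h k; apply/eqP; apply: contrapT => /negP ne; apply: h; exists k.
have mU : measurable (\bigcup_k F k) by exact: bigcupT_measurable.
rewrite probability_setC // (_ : nu _ = 0%E) ?sube0 //.
apply/negligibleP => //; apply: negligible_bigcup => k.
by apply/negligibleP; [exact: mF|exact: F0].
Qed.

Definition markov_entropy : R := - \sum_ij law nu (@edge n) ij * ln (T ij.1 ij.2).

(** The logarithm of a word probability is a sum over its initial letter and its edges; by
    invariance every edge has the same expectation, so the block entropy is affine in [m]. *)
Lemma entropy_word m : \sum_w eta (law nu (word m.+1) w) =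
  (- \sum_a law nu (fun x : Sp => x 0%N) a * ln (p 0 a)) + m%:R * markov_entropy.
Proof.
have mw := @measurable_word n m.+1.
have E w : eta (law nu (word m.+1) w) =
    - (law nu (word m.+1) w * ln (p 0 (nth ord0 w 0)) +
    \sum_(j < m) law nu (word m.+1) w * ln (T (nth ord0 w j) (nth ord0 w j.+1))).
  rewrite /eta; congr (- _); rewrite -mulr_sumr -mulrDr.
  have [->|ne] := eqVneq (law nu (word m.+1) w) 0; first by rewrite !mul0r.
  congr (_ * _); rewrite law_word wtE.
  have -> : thead w = nth ord0 w 0 by rewrite /thead (tnth_nth ord0).
  have lw : 0 < p 0 (nth ord0 w 0) * \prod_(j < m) T (nth ord0 w j) (nth ord0 w j.+1).
    rewrite lt_neqAle eq_sym mulr_ge0 ?andbT //; last by apply: prodr_ge0.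
    by move: ne; rewrite law_word wtE /thead (tnth_nth ord0).
  have := ltW lw; move: lw.
  rewrite lt_neqAle eq_sym mulf_eq0 negb_or => /andP[/andP[pn pr_n] _] _.
  have Tn j : 0 < T (nth ord0 w (j : 'I_m)) (nth ord0 w j.+1).
    rewrite lt_neqAle T0 andbT eq_sym.
    by move/prodf_neq0 : pr_n => /(_ j); exact.
  rewrite lnM ?posrE; [|by rewrite lt_neqAle eq_sym pn p0|exact: prodr_gt0].
  by rewrite ln_prod.
under eq_bigr do rewrite E.
rewrite sumrN big_split /= exchange_big /= opprD; congr (- _ + _).
  rewrite -(expect_comp nu (fun w : m.+1.-tuple Sig => nth ord0 w 0) (fun a => ln (p 0 a)) mw).
  by apply: eq_bigr => a _; congr (law _ _ _ * _); apply/funext => x /=; rewrite nth_word.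
rewrite /markov_entropy mulrN; congr (- _).
rewrite mulr_natl -[m in _ *+ m]card_ord -sumr_const; apply: eq_bigr => j _.
rewrite -(expect_comp nu (fun w : m.+1.-tuple Sig => (nth ord0 w j, nth ord0 w j.+1))
    (fun ij => ln (T ij.1 ij.2)) mw).
rewrite -(law_shift j markov_shift_invariant (@measurable_edge n)); apply: eq_bigr => ij _.
congr (law _ _ _ * _); apply/funext => x; rewrite [LHS]/comp [RHS]/comp /edge.
by rewrite !iter_shiftE addn0 addn1 /= !nth_word ?ltnS ?(ltnW (ltn_ord j)).
Qed.

(** The partition by the first letter already has entropy rate equal to the slope of the affine
    block entropy. *)
Lemma markov_ks_entropy_ge : (markov_entropy%:E <= ks_entropy nu)%E.
Proof.
pose lab (x : Sp) := x 0%N.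
pose al i : set Sp := lab @^-1` [set i].
apply: ereal_sup_ubound; exists n.+1, al; split.
  split; first by move=> i; exact: (@measurable_coord n 0).
  split; last by move=> x; exists (lab x).
  move=> i j ij; apply/seteqP; split=> // x [/= xi xj].
  by move/eqP: ij; rewrite -xi -xj.
congr EFin; apply/esym/cvg_lim => //.
rewrite -cvg_shiftS /=.
set c := - \sum_a law nu lab a * ln (p 0 a).
(* A block of [m.+1] letters has only [m] edges: with slope [h], [(c + m h) / (m + 1) = h + (c - h)
   / (m + 1)]. *)
rewrite (_ : (fun _ => _) = (fun m => markov_entropy + (c - markov_entropy) * @harmonic R m)).
  have : markov_entropy + (c - markov_entropy) * harmonic m @[m --> \oo] -->
      markov_entropy + (c - markov_entropy) * 0.
    by apply: cvgD; [exact: cvg_cst|apply: cvgMr; exact: cvg_harmonic].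
  by rewrite mulr0 addr0.
apply/funext => m; rewrite (@part_entropyE _ _ nu _ al lab) // entropy_itinerary_word entropy_word.
rewrite -/c /harmonic /= -natr1.
have : m%:R + 1 != 0 :> R by rewrite natr1 pnatr_eq0.
by move=> h; field.
Qed.

Lemma markov_pressure_ge (C P : 'M[R]_n.+1) : nu (sft C) = 1%E ->
  ((markov_entropy + \sum_ij law nu (@edge n) ij * ln (P ij.1 ij.2))%:E
    <= pressure (sft C) (phiP P))%E.
Proof.
move=> C1; apply: (@le_trans _ _ (ks_entropy nu + \int[nu]_(x in sft C) (phiP P x)%:E)%E).
  rewrite EFinD leeD ?markov_ks_entropy_ge //.
  rewrite -(integral_finite_valued (fun ij => ln (P ij.1 ij.2)) (@measurable_edge n)
    (measurable_sft C) C1) //.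
apply: ereal_sup_ubound; exists nu => //; split=> //.
exact: markov_shift_invariant.
Qed.

End MarkovMeasure.

(** * Edge frequencies of Gibbs-weighted words *)

Lemma sum_pairE (R : realType) (T U : finType) (F : T * U -> R) :
  \sum_tu F tu = \sum_t \sum_u F (t, u).
Proof. by rewrite pair_bigA; apply: eq_bigr => -[]. Qed.

(** * Continuity of the entropy function *)

Section EtaContinuity.
Variable R : realType.

Lemma eta0 : eta (0 : R) = 0.
Proof. by rewrite /eta mul0r oppr0. Qed.

(** Apply [ln x <= x - 1] at the inverse of the square root of [t]. The bound gives continuity of
    [eta] at 0. *)
Lemma eta_le_sqrt (t : R) : 0 < t -> eta t <= 2 * Num.sqrt t.
Proof.
move=> t0; set s := Num.sqrt t.
have s0 : 0 < s by rewrite sqrtr_gt0.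
have ts : t = s ^+ 2 by rewrite sqr_sqrtr // ltW.
have := ln_le_sub1 (_ : 0 < s^-1); rewrite invr_gt0 => /(_ s0).
rewrite lnV ?posrE // /eta ts lnXn ?posrE // => h.
have -> : - (s ^+ 2 * (ln s *+ 2)) = 2 * s * (s * - ln s) by ring.
rewrite -[leRHS]mulr1 ler_pM2l ?mulr_gt0 //.
have : s * - ln s <= s * (s^-1 - 1) by rewrite ler_pM2l.
by rewrite mulrBr divff ?gt_eqF // mulr1; move/le_trans; apply; rewrite gerBl ltW.
Qed.

Lemma continuous_eta (x : R) : 0 <= x -> {for x, continuous (@eta R)}.
Proof.
rewrite le_eqVlt => /predU1P[<-|x0]; last first.
  by apply: cvgN; apply: cvgM; [exact: cvg_id|exact: continuous_ln].
rewrite /prop_for /continuous_at eta0; apply/cvgrPdist_lt => e e0.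
(* The bound 1 makes [eta t] nonnegative; the other makes twice the square root of [t] less than
   [e]. For [t <= 0] the convention for [ln] gives [eta t = 0]. *)
pose d := Num.min 1 ((e / 2) ^+ 2).
have d0 : 0 < d by rewrite lt_min ltr01 exprn_gt0 // divr_gt0.
near=> t; rewrite sub0r normrN.
have td : `|t| < d.
  by near: t; have := nbhsx_ballx (0 : R) d d0; apply: filterS => t; rewrite /ball /= sub0r normrN.
have [t0|t0] := leP t 0; first by rewrite /eta ln0 // mulr0 oppr0 normr0.
move: td; rewrite gtr0_norm // lt_min => /andP[t1 te].
rewrite ger0_norm; last first.
  by rewrite /eta -mulrN mulr_ge0 ?(ltW t0) // oppr_ge0 ln_le0 // ltW.
apply: le_lt_trans (eta_le_sqrt t0) _.
have : Num.sqrt t < e / 2.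
  by rewrite -[e / 2]ger0_norm ?divr_ge0 ?(ltW e0) // -sqrtr_sqr ltr_sqrt // exprn_gt0 // divr_gt0.
by lra.
Unshelve. all: by end_near.
Qed.

End EtaContinuity.

Section EdgeAverages.
Variables (n : nat) (R : realType) (M : 'M[R]_n.+1).
Local Notation Sig := 'I_n.+1.
Hypothesis M0 : forall i j, 0 <= M i j.
Hypothesis M1 : forall i, \sum_j M i j <= 1.
Hypothesis Zpos : forall m, 0 < Z M m.

Definition row_marginal (q : Sig * Sig -> R) (i : Sig) := \sum_j q (i, j).

(** The conditional entropy of the second vertex given the first, plus the mean logarithm of [M].
    Written without quotients, it is continuous in [q] even where a row marginal vanishes. *)
Definition free_energy (q : Sig * Sig -> R) : R :=
  \sum_ij eta (q ij) - \sum_i eta (row_marginal q i)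
  + \sum_ij q ij * ln (M ij.1 ij.2).

Lemma free_energyE (q : Sig * Sig -> R) (T : Sig -> Sig -> R) :
  (forall ij, 0 <= q ij) ->
  (forall ij, 0 < q ij -> T ij.1 ij.2 = q ij / row_marginal q ij.1) ->
  free_energy q =
  - \sum_ij q ij * ln (T ij.1 ij.2) + \sum_ij q ij * ln (M ij.1 ij.2).
Proof.
move=> q0 hT; rewrite /free_energy; congr (_ + _).
have -> : \sum_i eta (row_marginal q i) = - \sum_ij q ij * ln (row_marginal q ij.1).
  rewrite sum_pairE /=.
  by rewrite -sumrN; apply: eq_bigr => i _; rewrite -mulr_suml.
rewrite opprK -sumrN -big_split /=; apply: eq_bigr => -[i j] _ /=.
have [->|qn] := eqVneq (q (i, j)) 0; first by rewrite eta0 !mul0r oppr0 addr0.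
have qp : 0 < q (i, j) by rewrite lt_neqAle eq_sym qn q0.
have rp : 0 < row_marginal q i.
  by rewrite /row_marginal (bigD1 j) //= ltr_pwDl // sumr_ge0.
by have /= -> := hT (i, j) qp; rewrite ln_div ?posrE // /eta; ring.
Qed.

Let edge_at m (w : m.+1.-tuple Sig) (t : nat) := (nth ord0 w t, nth ord0 w t.+1).

Let gibbs_wt m (w : m.+1.-tuple Sig) : R := wt M w / Z M m.

(* Expected frequency of an edge when words are drawn with the Gibbs weights;
   junk value [0] at [m = 0]. *)
Definition edge_average m (ij : Sig * Sig) : R :=
  m%:R^-1 * \sum_(w : m.+1.-tuple Sig)
    gibbs_wt w * \sum_(t < m) (edge_at w t == ij)%:R.

Let gibbs_wt_ge0 m (w : m.+1.-tuple Sig) : 0 <= gibbs_wt w.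
Proof. by rewrite divr_ge0 ?wt_ge0 ?(ltW (Zpos m)). Qed.

Let gibbs_wt_sum m : \sum_(w : m.+1.-tuple Sig) gibbs_wt w = 1.
Proof. by rewrite -mulr_suml sum_wt divff // gt_eqF. Qed.

Let edge_averageE m (g : Sig * Sig -> R) :
  \sum_ij edge_average m ij * g ij =
  m%:R^-1 * \sum_(w : m.+1.-tuple Sig) gibbs_wt w * \sum_(t < m) g (edge_at w t).
Proof.
under eq_bigr do rewrite -mulrA mulr_suml.
rewrite -mulr_sumr exchange_big /=; congr (_ * _); apply: eq_bigr => w _.
under eq_bigr do rewrite -mulrA mulr_suml.
rewrite -mulr_sumr exchange_big /=; congr (_ * _); apply: eq_bigr => t _.
rewrite (bigD1 (edge_at w t)) //= eqxx mul1r big1 ?addr0 // => ij ne.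
by rewrite eq_sym (negbTE ne) mul0r.
Qed.

Lemma edge_average_ge0 m ij : 0 <= edge_average m ij.
Proof.
rewrite mulr_ge0 ?invr_ge0 //; apply: sumr_ge0 => w _.
by rewrite mulr_ge0 // sumr_ge0.
Qed.

Lemma edge_average_sum m : (0 < m)%N -> \sum_ij edge_average m ij = 1.
Proof.
move=> m0; have := edge_averageE m (fun=> 1).
under eq_bigr do rewrite mulr1; move=> ->.
rewrite -mulr_suml gibbs_wt_sum mul1r sumr_const card_ord mulVf //.
by rewrite pnatr_eq0 -lt0n.
Qed.

Lemma edge_average_support m i j : M i j = 0 -> edge_average m (i, j) = 0.
Proof.
move=> Mij; rewrite /edge_average big1 ?mulr0 // => w _.
have [->|wn] := eqVneq (gibbs_wt w) 0; first by rewrite mul0r.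
rewrite big1 ?mulr0 // => t _; case: eqP => // -[ei ej]; case/negP: wn.
by rewrite /gibbs_wt wtE (bigD1 t) //= ei ej Mij !mul0r.
Qed.

(** Along one word the departures from [i] minus the arrivals at [i] telescope to a difference
    between the first and the last letter. *)
Lemma edge_average_marginals m i : (0 < m)%N ->
  `|row_marginal (edge_average m) i - \sum_j edge_average m (j, i)| <= m%:R^-1.
Proof.
move=> m0.
have -> : row_marginal (edge_average m) i - \sum_j edge_average m (j, i) =
    \sum_ij edge_average m ij * ((ij.1 == i)%:R - (ij.2 == i)%:R).
  under [in RHS]eq_bigr do rewrite mulrBr.
  rewrite sumrB; congr (_ - _).
    rewrite sum_pairE /=.
    rewrite (bigD1 i) //= eqxx [X in _ + X]big1 ?addr0 => [|a /negbTE ->].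
      by apply: eq_bigr => j _; rewrite mulr1.
    by apply: big1 => j _; rewrite mulr0.
  rewrite sum_pairE /=.
  apply: eq_bigr => a _; rewrite (bigD1 i) //= eqxx mulr1 big1 ?addr0 // => b /negbTE ->.
  by rewrite mulr0.
rewrite edge_averageE /= normrM ger0_norm ?invr_ge0 // ler_piMr ?invr_ge0 //.
apply: le_trans (ler_norm_sum _ _ _) _; rewrite -[leRHS](gibbs_wt_sum m).
apply: ler_sum => w _; rewrite normrM ger0_norm // ler_piMr //.
pose F t : R := (nth ord0 w t == i)%:R.
have -> : \sum_(t < m) ((nth ord0 w t == i)%:R - (nth ord0 w t.+1 == i)%:R) = F 0%N - F m.
  rewrite -(big_mkord xpredT (fun t => F t - F t.+1)) -opprB.
  rewrite -(telescope_sumr F) // -sumrN.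
  by apply: eq_bigr => t _; rewrite opprB.
rewrite /F; do 2![case: eqP => _] => /=; by rewrite ?subrr ?subr0 ?sub0r ?normrN ?normr0 ?normr1 ?ler01.
Qed.

(* Gibbs' inequality compares the Gibbs weights with the Markov chain of the same
   edge frequencies, started uniformly: hence the error [ln n.+1 / m]. *)
Lemma edge_average_free_energy m : (0 < m)%N ->
  ln (Z M m) / m%:R <= ln n.+1%:R / m%:R + free_energy (edge_average m).
Proof.
move=> m0; have mp : 0 < m%:R :> R by rewrite ltr0n.
set q := edge_average m.
have q0 ij : 0 <= q ij by exact: edge_average_ge0.
have r0 i : 0 <= row_marginal q i by exact: sumr_ge0.
(* Division by 0 makes the rows of unvisited letters zero, so [T] is only substochastic. *)
pose T : 'M[R]_n.+1 := \matrix_(i, j) (q (i, j) / row_marginal q i).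
have T0 i j : 0 <= T i j by rewrite mxE divr_ge0.
have T1 i : \sum_j T i j <= 1.
  under eq_bigr do rewrite mxE.
  rewrite -mulr_suml -/(row_marginal q i).
  by have [->|rn] := eqVneq (row_marginal q i) 0; [rewrite mul0r|rewrite divff].
have N0 : 0 < n.+1%:R :> R by rewrite ltr0n.
pose tau (w : m.+1.-tuple Sig) := wt T w / n.+1%:R.
have tau0 w : 0 <= tau w by rewrite divr_ge0 ?wt_ge0.
have tau1 : \sum_w tau w <= 1.
  by rewrite -mulr_suml sum_wt ler_pdivrMr // mul1r; exact: Z_le.
have wpos (w : m.+1.-tuple Sig) : 0 < gibbs_wt w -> forall t : 'I_m,
    0 < M (nth ord0 w t) (nth ord0 w t.+1) /\ 0 < T (nth ord0 w t) (nth ord0 w t.+1).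
  move=> gw t.
  have Mt : 0 < M (nth ord0 w t) (nth ord0 w t.+1).
    rewrite lt_neqAle M0 andbT eq_sym; apply/eqP => e.
    by move: gw; rewrite /gibbs_wt wtE (bigD1 t) //= e !mul0r ltxx.
  have qt : 0 < q (edge_at w t).
    rewrite mulr_gt0 ?invr_gt0 // (bigD1 w) //= ltr_pwDl //; last first.
      by apply: sumr_ge0 => v _; rewrite mulr_ge0 // sumr_ge0.
    by rewrite mulr_gt0 // (bigD1 t) //= eqxx ltr_pwDl // sumr_ge0.
  split=> //; rewrite mxE divr_gt0 //.
  by rewrite /row_marginal (bigD1 (nth ord0 w t.+1)) //= ltr_pwDl // sumr_ge0.
have taupos w : 0 < gibbs_wt w -> 0 < tau w.
  move=> gw; rewrite divr_gt0 // wtE; apply: prodr_gt0 => t _.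
  by have [] := wpos w gw t.
have := gibbs (@gibbs_wt_ge0 m) (gibbs_wt_sum m) tau0 tau1 taupos.
(* Used twice: for [M] with [c = Z M m], which is the Gibbs entropy, and for [T] with [c] the number
   of letters, which is the cross term. *)
have lnE (L : 'M[R]_n.+1) (c : R) : 0 < c ->
    (forall w : m.+1.-tuple Sig, 0 < gibbs_wt w ->
      forall t : 'I_m, 0 < L (nth ord0 w t) (nth ord0 w t.+1)) ->
    \sum_(w : m.+1.-tuple Sig) gibbs_wt w * ln (wt L w / c) =
    m%:R * (\sum_ij q ij * ln (L ij.1 ij.2)) - ln c.
  move=> c0 Lpos; rewrite edge_averageE mulrA divff ?gt_eqF // mul1r.
  rewrite -[ln c]mul1r -(gibbs_wt_sum m) mulr_suml -sumrB.
  apply: eq_bigr => w _; rewrite -mulrBr.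
  have [->|gn] := eqVneq (gibbs_wt w) 0; first by rewrite !mul0r.
  have gw : 0 < gibbs_wt w by rewrite lt_neqAle eq_sym gn gibbs_wt_ge0.
  congr (_ * _); rewrite wtE ln_div ?posrE //; last by apply: prodr_gt0 => t _; exact: Lpos.
  by rewrite ln_prod // => t; exact: Lpos.
have -> : \sum_(w : m.+1.-tuple Sig) eta (gibbs_wt w) =
    - (m%:R * (\sum_ij q ij * ln (M ij.1 ij.2)) - ln (Z M m)).
  by rewrite -lnE // ?sumrN // => w gw t; have [] := wpos w gw t.
rewrite lnE //; last by move=> w gw t; have [] := wpos w gw t.
rewrite (@free_energyE q T) //; last by move=> ij _; rewrite mxE -surjective_pairing.
rewrite ler_pdivrMr //; set a := \sum_ij q ij * ln (T _ _).
set b := \sum_ij q ij * ln (M _ _).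
have -> : (ln n.+1%:R / m%:R + (- a + b)) * m%:R = ln n.+1%:R + m%:R * b - m%:R * a.
  by field; rewrite gt_eqF.
lra.
Qed.

End EdgeAverages.

(** * Convergence to the pressure *)

Section LimitLemmas.

Lemma ultra_fmap (T S : Type) (U : set_system T) (f : T -> S) :
  UltraFilter U -> UltraFilter (f @ U).
Proof.
move=> UU; split; first exact: fmap_proper_filter.
move=> G PG UG; apply/seteqP; split=> // A GA.
have [//|UC] := in_ultra_setVsetC (f @^-1` A) UU.
have : G (~` A) by apply: UG.
by move=> GC; case: (@filter_not_empty _ G PG); rewrite -(setICr A); exact: filterI.
Qed.

(** Compactness of the unit interval; an ultrafilter replaces successive extraction of
    subsequences. *)
Lemma ultra_bounded_cvg (R : realType) (T : Type) (U : set_system T) (u : T -> R) :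
  UltraFilter U -> (\forall m \near U, 0 <= u m <= 1) ->
  exists l : R, u m @[m --> U] --> l.
Proof.
move=> UU bu; have UfU := ultra_fmap u UU.
have cI : compact (`[0, 1]%classic : set R) by exact: segment_compact.
move: cI; rewrite compact_ultra => /(_ _ UfU) h.
have [|l [_ hl]] := h; last by exists l.
by rewrite /fmap /=; apply: filterS bu => m; rewrite /= in_itv.
Qed.

Lemma cvg_sumr (R : realType) (T : Type) (F : set_system T) (I : finType)
    (f : I -> T -> R) (l : I -> R) : Filter F ->
  (forall i, f i m @[m --> F] --> l i) ->
  \sum_i f i m @[m --> F] --> \sum_i l i.
Proof.
move=> FF fl; elim: (index_enum I) => [|i s IH].
  by rewrite big_nil; under eq_fun do rewrite big_nil; exact: cvg_cst.
by rewrite big_cons; under eq_fun do rewrite big_cons; exact: cvgD.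
Qed.

Lemma cvg_div_nat (R : realType) (c : R) : c / m%:R @[m --> \oo] --> (0 : R).
Proof.
rewrite -cvg_shiftS /=.
have : c * harmonic m @[m --> \oo] --> c * 0 by apply: cvgMr; exact: cvg_harmonic.
by rewrite mulr0.
Qed.

End LimitLemmas.

(** * Realization of balanced edge frequencies by Markov measures *)

Section Realization.
Variables (n : nat) (R : realType) (C P : 'M[R]_n.+1).
Local Notation Sig := 'I_n.+1.

Lemma free_energy_le_pressure (q : Sig * Sig -> R) :
  (forall ij, 0 <= q ij) -> \sum_ij q ij = 1 ->
  (forall i, row_marginal q i = \sum_j q (j, i)) ->
  (forall i j, 0 < q (i, j) -> C i j = 1) ->
  ((free_energy P q)%:E <= pressure (sft C) (phiP P))%E.
Proof.
move=> q0 q1 qst qC.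
have r0 i : 0 <= row_marginal q i by exact: sumr_ge0.
pose p : 'rV[R]_n.+1 := \row_i row_marginal q i.
(* Rows of marginal zero receive a unit mass so that [T] is stochastic; there [p] vanishes, so
   [p 0 i * T i j = q (i, j)] still holds. *)
pose T : 'M[R]_n.+1 := \matrix_(i, j)
  if row_marginal q i == 0 then (j == ord0)%:R else q (i, j) / row_marginal q i.
have T0 i j : 0 <= T i j by rewrite mxE; case: ifP => // _; rewrite divr_ge0.
have pT i j : p 0 i * T i j = q (i, j).
  rewrite !mxE; case: ifPn => [/eqP r|r]; last by rewrite mulrCA divff // mulr1.
  rewrite r mul0r; apply/esym/eqP; rewrite eq_le q0 andbT -r /row_marginal (bigD1 j) //=.
  by rewrite lerDl sumr_ge0.
have dT i : distr (T i).
  split=> //; under eq_bigr do rewrite mxE.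
  have [r|r] := eqVneq (row_marginal q i) 0; last by rewrite -mulr_suml divff.
  by rewrite (bigD1 ord0) //= big1 ?addr0 // => j /negbTE ->.
have p0 i : 0 <= p 0 i by rewrite mxE.
have dp : distr (p 0).
  by split=> //; under eq_bigr do rewrite mxE; rewrite -q1 sum_pairE.
have pTp : p *m T = p.
  apply/rowP => j; rewrite [LHS]mxE [RHS]mxE qst.
  by apply: eq_bigr => i _; exact: pT.
have [nu nuM] := markov_measure_exists dT dp.
have lE : law nu (@edge n) = q by apply/funext => -[i j]; rewrite (law_edge nuM) /= pT.
have C1 : nu (sft C) = 1%E.
  by apply: (markov_sft_full nuM pTp p0 T0) => i j; rewrite pT; exact: qC.
apply: le_trans (markov_pressure_ge nuM pTp p0 T0 P C1).
rewrite lee_fin (@free_energyE n R P q T) //; last first.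
  move=> [i j] /= qp; rewrite mxE ifF //.
  by apply/negbTE; rewrite gt_eqF // /row_marginal (bigD1 j) //= ltr_pwDl // sumr_ge0.
by rewrite /markov_entropy lE.
Qed.

End Realization.

(** * The exponential growth rate of the path sums *)

Section Core.
Variables (n : nat) (R : realType) (C P : 'M[R]_n.+1).
Local Notation Sig := 'I_n.+1.
Local Notation Sp := (SpaceT n).
Hypothesis P0 : forall i j, 0 <= P i j.
Hypothesis P1 : forall i, \sum_j P i j = 1.
Hypothesis CP : forall i j, C i j = 1 -> 0 < P i j.

Definition restrict_mx : 'M[R]_n.+1 :=
  \matrix_(i, j) if C i j == 1 then P i j else 0.
Local Notation M := restrict_mx.

Lemma restrict_mx_ge0 i j : 0 <= M i j.
Proof. by rewrite mxE; case: ifP. Qed.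

Lemma restrict_mx_sum i : \sum_j M i j <= 1.
Proof. by rewrite -(P1 i); apply: ler_sum => j _; rewrite mxE; case: ifP. Qed.

Lemma restrict_mxE i j : C i j = 1 -> M i j = P i j.
Proof. by move=> c; rewrite mxE c eqxx. Qed.

Lemma restrict_mx_gt0 i j : C i j = 1 -> 0 < M i j.
Proof. by move=> c; rewrite restrict_mxE // CP. Qed.

(** A point of [sft C] would give a word of positive weight, so there is no point and no invariant
    measure: the supremum is over the empty set. *)
Lemma pressure_sft_empty m : Z M m = 0 -> pressure (sft C) (phiP P) = -oo%E.
Proof.
move=> Z0; rewrite /pressure; set S := (S in ereal_sup S).
suff -> : S = set0 by rewrite ereal_sup0.
apply/seteqP; split=> // e [nu [C1 _] _].
have C0 : sft C = set0.
  apply/seteqP; split=> // x Cx.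
  by have := Z_gt0 restrict_mx_ge0 restrict_mx_gt0 m Cx; rewrite Z0 ltxx.
by move: C1; rewrite C0 measure0 => /eqP; rewrite eq_sym onee_eq0.
Qed.

Hypothesis Zpos : forall m, 0 < Z M m.

(** [f] is the free energy of the limit [q] of the edge averages along [U]. The marginal defect
    [1 / m] and the error [ln n.+1 / m] vanish along [U], so [q] is balanced and continuity gives
    the lower bound. *)
Lemma ultra_free_energy (U : set_system nat) : UltraFilter U -> \oo `<=` U ->
  exists f : R, (f%:E <= pressure (sft C) (phiP P))%E /\
    forall a, U [set m | a <= ln (Z M m) / m%:R] -> a <= f.
Proof.
move=> UU ooU.
have Upos : \forall m \near U, (0 < m)%N by apply: ooU; exists 1%N.
have av0 := edge_average_ge0 restrict_mx_ge0 Zpos.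
have av1 := edge_average_sum Zpos.
have /choice[q qP] : forall ij, exists l : R, edge_average M m ij @[m --> U] --> l.
  move=> ij; apply: ultra_bounded_cvg; apply: filterS Upos => m m0.
  rewrite av0 /= -(av1 _ m0) (bigD1 ij) //= lerDl; exact: sumr_ge0.
have q0 ij : 0 <= q ij.
  by apply: (closed_cvg (fun x : R => 0 <= x) _ _ _ (qP ij)); [exact: closed_ge|exact: nearW].
have q1 : \sum_ij q ij = 1.
  apply: (cvg_unique _ (cvg_sumr _ qP)) => //.
  apply: cvg_near_cst; apply: filterS Upos => m; exact: av1.
have rP i : row_marginal (edge_average M m) i @[m --> U] --> row_marginal q i.
  by apply: cvg_sumr => j; exact: qP.
have harmU (c : R) : c / m%:R @[m --> U] --> (0 : R).
  by apply: cvg_trans (cvg_div_nat c); apply: cvg_app.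
have qst i : row_marginal q i = \sum_j q (j, i).
  apply/eqP; rewrite -subr_eq0; apply/eqP.
  have cP : \sum_j edge_average M m (j, i) @[m --> U] --> \sum_j q (j, i).
    by apply: cvg_sumr => j; exact: qP.
  apply: (cvg_unique _ (cvgB (rP i) cP)) => //.
  apply/cvgrPdist_le => e e0.
  have := harmU 1; move/cvgrPdist_le => /(_ e e0).
  apply: filterS2 Upos => m m0; rewrite !sub0r !normrN div1r ger0_norm ?invr_ge0 //.
  exact: le_trans (edge_average_marginals restrict_mx_ge0 Zpos i m0).
have qC i j : 0 < q (i, j) -> C i j = 1.
  move=> qp; apply/eqP; apply: contraT => nC.
  have z m : edge_average M m (i, j) = 0.
    by apply: edge_average_support; rewrite mxE (negbTE nC).
  suff : q (i, j) = 0 by move=> e; rewrite e ltxx in qp.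
  apply: (cvg_unique _ (qP (i, j))) => //.
  by apply: cvg_near_cst; exact: nearW.
exists (free_energy P q); split; first exact: free_energy_le_pressure.
move=> a Ua.
(* [q] charges only edges of [C], where [P] and [M] agree. *)
have -> : free_energy P q = free_energy M q.
  congr (_ + _); apply: eq_bigr => -[i j] _ /=.
  have [->|qn] := eqVneq (q (i, j)) 0; first by rewrite !mul0r.
  by rewrite restrict_mxE //; apply: qC; rewrite lt_neqAle eq_sym qn q0.
have fc : ln n.+1%:R / m%:R + free_energy M (edge_average M m) @[m --> U] -->
    0 + free_energy M q.
  apply: cvgD; first exact: harmU.
  apply: cvgD; [apply: cvgB|]; apply: cvg_sumr.
  - by move=> ij; apply: continuous_cvg (qP ij); exact: continuous_eta.
  - move=> i; apply: continuous_cvg (rP i); apply: continuous_eta; exact: sumr_ge0.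
  - by move=> ij; apply: cvgM (qP ij) _; exact: cvg_cst.
rewrite add0r in fc.
apply: (closed_cvg (fun x : R => a <= x) _ _ _ fc); first exact: closed_ge.
apply: filterS2 Upos Ua => m m0 /le_trans; apply.
exact: (edge_average_free_energy restrict_mx_ge0 Zpos).
Qed.

(** Some invariant measure and finite partition have entropy plus integral above [a];
    [entropy_upper], divided by [m], carries this over to [Z]. *)
Lemma pressure_gt_near (a : R) : (a%:E < pressure (sft C) (phiP P))%E ->
  \forall m \near \oo, a < ln (Z M m) / m%:R.
Proof.
move=> /ereal_sup_gt[_ [nu [C1 inv] <-]].
have -> : (\int[nu]_(x in sft C) (phiP P x)%:E)%E =
    (\sum_ij law nu (@edge n) ij * ln (P ij.1 ij.2))%:E.
  exact: (integral_finite_valued (fun ij => ln (P ij.1 ij.2)) (@measurable_edge n)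
    (measurable_sft C) C1).
have -> : \sum_ij law nu (@edge n) ij * ln (P ij.1 ij.2) =
    \sum_ij law nu (@edge n) ij * ln (M ij.1 ij.2).
  apply: eq_bigr => ij _.
  have [->|ln] := eqVneq (law nu (@edge n) ij) 0; first by rewrite !mul0r.
  have lp : 0 < law nu (@edge n) ij by rewrite lt_neqAle eq_sym ln law_ge0.
  have [x Cx <-] := law_gt0 (@measurable_edge n) (measurable_sft C) C1 lp.
  by rewrite restrict_mxE //; exact: Cx.
set I := \sum_ij _ => aI.
have : ((a - I)%:E < ks_entropy nu)%E by rewrite EFinB lteBlDr.
move=> /ereal_sup_gt[_ [k [al [/partition_label[lab mlab alE] ->]]]].
rewrite lte_fin; set h := entropy_wrt nu al => ah.
(* Three errors of size [d] occur, from the entropy limit, the channel and the [L] extra edges,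
   leaving a margin [d] above [a]. *)
pose d := (h + I - a) / 4.
have d0 : 0 < d by rewrite /d; lra.
have [L HL] := entropy_upper restrict_mx_ge0 restrict_mx_gt0 C1 inv mlab d0.
have Hh : \forall m \near \oo, h - d <= part_entropy nu al m / m%:R.
  (* [limn] of a divergent sequence is [0], below every [part_entropy]. *)
  have [cv|dv] := pselect (cvgn (fun m => part_entropy nu al m / m%:R)).
    by apply: (cvgr_ge _ cv); rewrite -/h ltrBlDr ltrDl.
  apply: nearW => m; rewrite /h /entropy_wrt dvgP //.
  apply: (@le_trans _ _ 0); first by rewrite subr_le0 ltW.
  rewrite divr_ge0 // (part_entropyE nu m alE); apply: sumr_ge0 => s _.
  have mi := @measurable_itinerary n k lab m mlab.
  by rewrite /eta -mulrN mulr_ge0 ?law_ge0 // oppr_ge0 ln_le0 // pr_le1.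
have near_d : \forall m \near \oo, - d <= L%:R * I / m%:R.
  by apply: (cvgr_ge _ (cvg_div_nat (L%:R * I))); rewrite oppr_lt0.
near=> m.
have m0 : (0 < m)%N by near: m; exists 1%N.
have mp : 0 < m%:R :> R by rewrite ltr0n.
have hH : h - d <= part_entropy nu al m / m%:R by near: m.
have hL : - d <= L%:R * I / m%:R by near: m.
have lnZ : ln (Z M (m + L)) <= ln (Z M m).
  by rewrite ler_ln ?posrE //; apply: Z_nonincr (leq_addr _ _);
    [exact: restrict_mx_ge0|exact: restrict_mx_sum].
have : (part_entropy nu al m + (m%:R + L%:R) * I) / m%:R <= (ln (Z M m) + m%:R * d) / m%:R.
  rewrite ler_pM2r ?invr_gt0 // -natrD (part_entropyE nu m alE).
  by apply: le_trans (HL m) _; rewrite lerD2r.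
have -> : (part_entropy nu al m + (m%:R + L%:R) * I) / m%:R =
    part_entropy nu al m / m%:R + I + L%:R * I / m%:R by field; rewrite gt_eqF.
have -> : (ln (Z M m) + m%:R * d) / m%:R = ln (Z M m) / m%:R + d.
  by field; rewrite gt_eqF.
move: hH hL; rewrite /d; lra.
Unshelve. all: by end_near.
Qed.

(** The lower bound for the limit is [pressure_gt_near]. If values above [r + e] recurred forever,
    an ultrafilter concentrated on them would yield a free energy of at least [r + e], above the
    pressure. *)
Lemma pressure_cvg : exists2 r : R, pressure (sft C) (phiP P) = r%:E &
  ln (Z M m) / m%:R @[m --> \oo] --> r.
Proof.
have [U0 [UU0 ooU0]] := ultraFilterLemma (eventually_filter).
have [f0 [f0p _]] := ultra_free_energy UU0 ooU0.
have Pfin : pressure (sft C) (phiP P) \is a fin_num.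
  (* Infinite pressure would force [ln (Z M m) / m] above [ln n.+1] eventually, contrary to
     [Z_le]. *)
  rewrite fin_numElt (lt_le_trans (ltNyr f0) f0p) /= ltNge leye_eq; apply/eqP => Py.
  have N1 : 0 <= ln n.+1%:R :> R by rewrite ln_ge0 // ler1n.
  have : \forall m \near \oo, ln n.+1%:R < ln (Z M m) / m%:R.
    by apply: pressure_gt_near; rewrite Py ltry.
  move=> [m0 _ /(_ m0.+1 (leqnSn _))] /=; apply/negP; rewrite -leNgt.
  rewrite ler_pdivrMr ?ltr0n //; apply: (@le_trans _ _ (ln n.+1%:R)).
    by rewrite ler_ln ?posrE ?ltr0n //; exact: (Z_le restrict_mx_ge0 restrict_mx_sum).
  by rewrite ler_peMr // ler1n.
exists (fine (pressure (sft C) (phiP P))); first by rewrite fineK.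
set r := fine _; have Pr : pressure (sft C) (phiP P) = r%:E by rewrite fineK.
apply/cvgrPdist_le => e e0.
have lo : \forall m \near \oo, r - e < ln (Z M m) / m%:R.
  by apply: pressure_gt_near; rewrite Pr lte_fin; lra.
have up : \forall m \near \oo, ln (Z M m) / m%:R <= r + e.
  apply: contrapT => nup.
  pose D := [set m | r + e <= ln (Z M m) / m%:R].
  (* Properness says that [D] is unbounded, which is the failure of the upper bound. *)
  have PF : ProperFilter (within D \oo).
    apply: Build_ProperFilter; rewrite /within /= => D0; apply: nup.
    apply: filterS D0 => m h.
    by rewrite leNgt; apply/negP => /ltW /h.
  have [U [UU DU]] := ultraFilterLemma PF.
  have ooU : \oo `<=` U by move=> A oA; apply: DU; rewrite /within /=; apply: filterS oA => m Am _.
  have [f [fp /(_ (r + e)) fU]] := ultra_free_energy UU ooU.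
  have : r + e <= f by apply: fU; apply: DU; exact: nearW.
  by move: fp; rewrite Pr lee_fin; lra.
near=> m; rewrite ler_distlC; apply/andP; split; first by apply/ltW; near: m.
by near: m.
Unshelve. all: by end_near.
Qed.

End Core.

(** * The measure of the survivor sets *)

Section Survivors.
Variables (n : nat) (R : realType) (A P : 'M[R]_n.+1) (p : 'rV[R]_n.+1).
Local Notation Sig := 'I_n.+1.
Local Notation Sp := (SpaceT n).
Hypothesis A01 : zero_one A.
Hypothesis PA : compatible_stochastic A P.
Hypothesis pP : stationary P p.

Let P0 i j : 0 <= P i j. Proof. by case: PA. Qed.
Let P1 i : \sum_j P i j = 1. Proof. by case: PA => _ []. Qed.
Let PA1 i j : 0 < P i j <-> A i j = 1. Proof. by case: PA => _ []. Qed.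
Let p0 i : 0 <= p 0 i. Proof. by case: pP. Qed.
Let p1 : \sum_i p 0 i = 1. Proof. by case: pP => _ []. Qed.
Let pPp : p *m P = p. Proof. by case: pP => _ []. Qed.

Lemma stationary_le1 i : p 0 i <= 1.
Proof. by rewrite -p1 (bigD1 i) //= lerDl sumr_ge0. Qed.

Lemma stationary_step i j : A i j = 1 -> 0 < p 0 i -> 0 < p 0 j.
Proof.
move=> /PA1 Pij pi; rewrite -pPp mxE (bigD1 i) //= ltr_pwDl ?mulr_gt0 //.
by apply: sumr_ge0 => k _; rewrite mulr_ge0.
Qed.

Lemma stationary_path m i j : 0 < (A ^+ m.+1) i j -> 0 < p 0 i -> 0 < p 0 j.
Proof.
elim: m i => [|m IH] i.
  rewrite expr1 => Aij; apply: stationary_step.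
  by case: (A01 i j) => // e; rewrite e ltxx in Aij.
rewrite exprS mxE => s pi.
have [k Ak Xk] : exists2 k, A i k = 1 & 0 < (A ^+ m.+1) k j.
  apply: contrapT => nk; move: s; apply/negP; rewrite -leNgt.
  apply: sumr_le0 => k _; case: (A01 i k) => e; rewrite e ?mul0r // mul1r.
  by rewrite leNgt; apply/negP => h; apply: nk; exists k.
exact: IH Xk (stationary_step Ak pi).
Qed.

(** Some letter has positive mass, and stationarity propagates positivity along the allowed paths
    that irreducibility provides. *)
Lemma stationary_gt0 j : irreducible_mx A -> 0 < p 0 j.
Proof.
move=> irr; have [i pi] : exists i, 0 < p 0 i.
  apply: contrapT => ni; have : \sum_i p 0 i <= 0.
    by apply: sumr_le0 => i _; rewrite leNgt; apply/negP => h; apply: ni; exists i.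
  by rewrite p1 ler10.
by have [m Aij] := irr i j; exact: stationary_path Aij pi.
Qed.

Lemma restrict_mx_id : restrict_mx A P = P.
Proof.
apply/matrixP => i j; rewrite mxE; case: ifPn => // /eqP nA.
apply/eqP; rewrite eq_le P0 /= leNgt; apply/negP => /PA1; exact: nA.
Qed.

(** Here the path sum is constantly [n.+1], so its growth rate is 0. *)
Lemma pressure_full : pressure (sft A) (phiP P) = 0%E.
Proof.
have Zp m : 0 < Z (restrict_mx A P) m by rewrite restrict_mx_id Z_stochastic // ltr0n.
have [r -> rc] := pressure_cvg P0 P1 (fun i j => (PA1 i j).2) Zp.
congr EFin; apply: (cvg_unique _ rc) => //.
rewrite (_ : (fun _ => _) = (fun m => ln n.+1%:R / m%:R)); first exact: cvg_div_nat.
by apply/funext => m; rewrite restrict_mx_id Z_stochastic.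
Qed.

Variables (G : {set Sig * Sig}) (mu : probability Sp R).
Hypothesis muM : is_markov_measure P p mu.
Local Notation B := (B_mx A G).
Local Notation M := (restrict_mx B P).

Lemma B_mxP i j : B i j = 1 <-> allowed2 A i j /\ (i, j) \notin G.
Proof.
rewrite mxE; case: ifPn => [/andP[/asboolP]//|nag]; split=> [/eqP|[a g]].
  by rewrite eq_sym oner_eq0.
by move/negP: nag; case; rewrite g andbT; exact/asboolP.
Qed.

Lemma B_mx_P i j : B i j = 1 -> 0 < P i j.
Proof. by move=> /B_mxP[[x [Ax [<- <-]]] _]; apply/PA1; exact: Ax. Qed.

Lemma survivorsE m : survivors A G m =
  [set x : Sp | forall i : 'I_m.+1, B (x i) (x i.+1) = 1] `&` sft A.
Proof.
apply/seteqP; split=> x.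
  move=> [Ax h]; split=> // i; apply/B_mxP; split.
    exists (iter i (@shift n) x); split.
      by move=> k; rewrite !iter_shiftE addnS; exact: Ax.
    by rewrite !iter_shiftE addn0 addn1.
  apply/negP => xG; apply: (h i); first by rewrite -ltnS.
  exists (x i, x i.+1) => //= -[|[|//]] _ /=; rewrite iter_shiftE ?addn0 ?addn1 //.
move=> [h Ax]; split=> // i im [[a b] /= abG c].
have := h (Ordinal (im : (i < m.+1)%N)) => /B_mxP[_ /=].
have := c 0%N isT; rewrite /= iter_shiftE addn0 => ->.
by have := c 1%N isT; rewrite /= iter_shiftE addn1 => ->; rewrite abG.
Qed.

(** Times 0 to [m] test [m.+1] edges, hence words of [m.+2] letters. Up to the full-measure set
    [sft A], survival is an event on such words, on which the weights for [P] and [M] agree. *)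
Lemma measure_survivors m :
  mu (survivors A G m) = (\sum_a p 0 a * Zfrom M m.+1 a)%:E.
Proof.
have A1 : mu (sft A) = 1%E.
  apply: (markov_sft_full muM pPp p0 P0) => i j pPij; apply/PA1.
  by rewrite lt_neqAle P0 andbT; apply: contraTneq pPij => <-; rewrite mulr0 ltxx.
have mw := @measurable_word n m.+2.
pose Q (w : m.+2.-tuple Sig) := [forall j : 'I_m.+1, B (nth ord0 w j) (nth ord0 w j.+1) == 1].
have -> : survivors A G m = [set x | Q (word m.+2 x)] `&` sft A.
  rewrite survivorsE; congr (_ `&` _); apply/seteqP; split=> x h.
    apply/forallP => j; apply/eqP.
    by rewrite (nth_word _ (ltnW (ltn_ord j) : (j < m.+2)%N))
      (nth_word _ (ltn_ord j : (j.+1 < m.+2)%N)).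
  move=> j; have /forallP/(_ j)/eqP := h.
  by rewrite (nth_word _ (ltnW (ltn_ord j) : (j < m.+2)%N))
    (nth_word _ (ltn_ord j : (j.+1 < m.+2)%N)).
have mQ := measurable_fibers_pred Q mw.
rewrite prE ?pr_setI_full //;
  [|exact: measurable_sft|apply: measurableI => //; exact: measurable_sft].
congr EFin; rewrite (pr_pred mu Q mw) big_mkcond -sum_init_chainprod.
apply: eq_bigr => w _; rewrite (law_word muM); case: ifPn => [/forallP Qw|].
  rewrite !wtE; congr (_ * _); apply: eq_bigr => j _.
  by rewrite restrict_mxE //; exact/eqP/Qw.
rewrite negb_forall => /existsP[j /negbTE nB].
by rewrite [wt M w]wtE (bigD1 j) //= mxE nB mul0r mulr0.
Qed.

End Survivors.

Theorem theorem3p6 (R : realType) (n : nat) (A P : 'M[R]_n.+1)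
  (p : 'rV[R]_n.+1) (mu : probability (SpaceT n) R)
  (G : {set 'I_n.+1 * 'I_n.+1}) :
  zero_one A -> irreducible_mx A ->
  compatible_stochastic A P -> stationary P p ->
  is_markov_measure P p mu ->
  (0 < #|G|)%N -> (forall w, w \in G -> allowed2 A w.1 w.2) ->
  escape_seq A G mu @ \oo -->
    (pressure (sft A) (phiP P) - pressure (sft (B_mx A G)) (phiP P))%E.
Proof.
move=> A01 irr PA pP muM _ _.
have P0 i j : 0 <= P i j by case: PA.
have P1 i : \sum_j P i j = 1 by case: PA => _ [].
have BP := B_mx_P PA (G := G).
set M := restrict_mx (B_mx A G) P.
have M0 : forall i j, 0 <= M i j by exact: restrict_mx_ge0.
have M1 : forall i, \sum_j M i j <= 1 by exact: restrict_mx_sum.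
pose y m := \sum_a p 0 a * Zfrom M m.+1 a.
have muy m : mu (survivors A G m) = (y m)%:E by exact: measure_survivors.
have ppos j : 0 < p 0 j by exact: (stationary_gt0 A01 PA pP).
have ple j : p 0 j <= 1 by exact: (stationary_le1 pP).
have yZ m : y m <= Z M m.+1.
  by apply: ler_sum => a _; rewrite ler_piMl // Zfrom_ge0.
rewrite (pressure_full PA) sub0e.
(* If some [Z M k] is zero, all later ones are: the pressure on the survivors is [-oo], the survivor
   sets are eventually null, and both sides are [+oo]. *)
have [Zp|] := pselect (forall m, 0 < Z M m); last first.
  move=> /existsNP[k /negP]; rewrite -leNgt => Zk.
  have Z0 m : (k <= m)%N -> Z M m = 0.
    move=> km; apply/eqP; rewrite eq_le Z_ge0 // andbT.
    by apply: le_trans Zk; exact: Z_nonincr.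
  rewrite (pressure_sft_empty P0 BP (Z0 k (leqnn k))) /=.
  (* Starting at [k.+1] also excludes [m = 0], where the factor [1 / m] is 0. *)
  apply: cvg_near_cst; exists k.+1 => // m /= km.
  rewrite /escape_seq (_ : mu _ = 0%E); last first.
    rewrite muy; congr EFin; apply/eqP; rewrite eq_le.
    rewrite (le_trans (yZ m)) ?Z0 //=; last by rewrite (leq_trans (ltnW km)).
    by apply: sumr_ge0 => a _; rewrite mulr_ge0 ?Zfrom_ge0 // ltW.
  rewrite /eln eqxx lt0_muleNy // -EFinN lte_fin oppr_lt0 invr_gt0 ltr0n.
  exact: leq_trans km.
have [r -> Lr] := pressure_cvg P0 P1 BP Zp; rewrite -/M in Lr.
(* A positive lower bound for every [p 0 j], since all factors are at most 1; it makes [y m]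
   comparable to [Z M m.+1]. *)
pose c := \prod_j p 0 j.
have c0 : 0 < c by exact: prodr_gt0.
have cp j : c <= p 0 j.
  rewrite /c (bigD1 j) //= ler_piMr ?(ltW (ppos j)) //.
  by apply: prodr_ile1 => i _; rewrite ple ltW.
have cZ m : c * Z M m.+1 <= y m.
  rewrite mulr_sumr; apply: ler_sum => a _; rewrite ler_wpM2r ?Zfrom_ge0 //.
have ypos m : 0 < y m by apply: lt_le_trans (cZ m); rewrite mulr_gt0.
have escE m : escape_seq A G mu m = (- (ln (y m) / m%:R))%:E.
  rewrite /escape_seq muy /eln ifF; last by rewrite eqe gt_eqF.
  by rewrite -EFinN -EFinM mulNr mulrC.
rewrite (_ : escape_seq A G mu = (fun m => (- (ln (y m) / m%:R))%:E)); last exact/funext.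
apply: cvg_EFin; first exact: nearW.
apply: cvgN.
(* The index is off by one: [1 / m = (1 / (m + 1)) (1 + 1 / m)]. *)
have LS : ln (Z M m.+1) / m%:R @[m --> \oo] --> r.
  have : ln (Z M m.+1) / m.+1%:R + ln (Z M m.+1) / m.+1%:R * (1 / m%:R) @[m --> \oo]
      --> r + r * 0.
    have Lr' : ln (Z M m.+1) / m.+1%:R @[m --> \oo] --> r by rewrite -cvg_shiftS in Lr.
    by apply: cvgD => //; apply: cvgM => //; exact: cvg_div_nat.
  rewrite mulr0 addr0; apply: cvg_trans; apply: near_eq_cvg.
  exists 1%N => // m /= m0; have mp : m%:R != 0 :> R by rewrite pnatr_eq0 -lt0n.
  by rewrite -natr1; field; rewrite mp natr1 pnatr_eq0.
have lo : ln c / m%:R + ln (Z M m.+1) / m%:R @[m --> \oo] --> r.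
  rewrite -[X in _ --> X]add0r; apply: cvgD => //; exact: cvg_div_nat.
apply: squeeze_cvgr lo LS; apply: nearW => m.
rewrite -mulrDl -lnM ?posrE // !ler_wpM2r ?invr_ge0 //= ler_ln ?posrE ?mulr_gt0 //.
Qed.
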